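(* The class $\mathrm{DH}_{\bullet}$ of connected distance-hereditary graphs rooted at a vertex is specified (for all sizes $n\ge 3$, both in the labeled and in the unlabeled setting) by \begin{align*} \mathrm{DH}_{\bullet} &= \mathcal{Z}_{\bullet}\times(\mathcal{K}+\mathcal{S}_C+\mathcal{S}_X)\\ \mathcal{K} &= \mathrm{Set}_{\ge 2}(\mathcal{Z}+\mathcal{S}_C+\mathcal{S}_X)\\ \mathcal{S}_C &= \mathrm{Set}_{\ge 2}(\mathcal{Z}+\mathcal{K}+\mathcal{S}_X)\\ \mathcal{S}_X &= \mathrm{Seq}_{\ge 2}(\mathcal{Z}+\mathcal{K}+\mathcal{S}_C). \end{align*}
   Context: All graphs are finite and simple. A split of a graph with vertex set $V$ is a bipartition $V=V_1\cup V_2$, $V_1\cap V_2=\emptyset$, with $|V_1|\ge 2$ and $|V_2|\ge 2$, such that every vertex of $V_1$ having a neighbour in $V_2$ is adjacent to every vertex of $V_2$ having a neighbour in $V_1$. A graph is distance-hereditary if it is totally decomposable for the split-decomposition, i.e. if every induced subgraph with at least 4 vertices contains a split. The size of a graph is its number of vertices. A graph rooted at a vertex is a graph with one distinguished vertex; in the unlabeled setting such objects are counted up to isomorphism preserving the distinguished vertex, in the labeled setting the vertices are identified with $\{1,\dots,n\}$. Combinatorial classes are in the sense of Flajolet and Sedgewick: $\mathcal{Z}$ is the class with a single object (an atom), of size $1$; $\mathcal{Z}_\bullet$ is also an atom of size $1$ (the root vertex) and is treated exactly as $\mathcal{Z}$ for generating functions; $+$ is disjoint union; $\times$ is Cartesian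 (labeled: labeled) product; $\mathrm{Set}_{\ge k}(\mathcal{A})$ is the class of sets (in the unlabeled setting: multisets) of at least $k$ objects of $\mathcal{A}$; $\mathrm{Seq}_{\ge k}(\mathcal{A})$ is the class of sequences of at least $k$ objects of $\mathcal{A}$, with generating function $A(z)^k/(1-A(z))$ in both settings. In the labeled setting, with exponential generating functions, $\mathrm{Set}_{\ge k}(\mathcal A)$ has generating function $\sum_{i\ge k}A(z)^i/i!$; in the unlabeled setting, with ordinary generating functions, the class $\mathrm{Set}(\mathcal A)$ of all multisets has generating function $\exp\big(\sum_{i\ge1}A(z^i)/i\big)$, and $\mathrm{Set}_{\ge k}$ is the restriction to multisets with at least $k$ elements. ''The class is specified by the system'' means: the system determines (uniquely, by recursion on size) auxiliary classes without objects of size $0$, and the class of graphs in question is isomorphic, as a combinatorial class, to the class given by the first equation, i.e. they have the same number of objects of each size $n$, in the labeled as well as in the unlabeled setting. By convention graphs of sizes $1$ and $2$ are excluded from this comparison. *)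

(* Defs.v *)
From HB Require Import structures.
From mathcomp Require Import all_boot all_fingroup finmap multiset.

Set Implicit Arguments.
Unset Strict Implicit.
Unset Printing Implicit Defensive.

Record sized := Sized { obj :> choiceType; size_of : obj -> nat }.

(* The constructions Set and Seq yield a combinatorial class only when the
   argument has no object of size 0; they are therefore defined on [sized],
   where finiteness is not required. *)
Record comb_class := CombClass {
  sized_of :> sized;
  _ : forall n, exists e : seq sized_of,
        forall x : sized_of, size_of x = n -> x \in e }.

Definition no_size0 (A : sized) := forall x : A, 0 < size_of x.

Definition equinumerous_at (A B : sized) (n : nat) :=
  exists f : {x : A | size_of x == n} -> {y : B | size_of y == n}, bijective f.

Definition class_iso (A B : sized) := forall n, equinumerous_at A B n.

Variant setting := Labeled | Unlabeled.

Definition catom : sized := @Sized unit (fun=> 1).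

Definition csum (A B : sized) : sized :=
  @Sized (A + B)%type
    (fun u => match u with inl a => size_of a | inr b => size_of b end).

Definition uprod (A B : sized) : sized :=
  @Sized (A * B)%type (fun p => size_of p.1 + size_of p.2).

Definition useq (k : nat) (A : sized) : sized :=
  @Sized {s : seq A | k <= size s} (fun s => \sum_(a <- val s) size_of a).

Definition uset (k : nat) (A : sized) : sized :=
  @Sized {m : {mset A}%mset | k <= size (enum_mset m)}
    (fun m => \sum_(a <- enum_mset (val m)) size_of a).

(* In the labeled setting an object of size n of a class stands for an object
   well-labeled by 1, ..., n.  The pair (L, a), where L has as many elements as
   the size of a, stands for a relabeled by L in the order-preserving way. *)
Definition relabeled (A : choiceType) := ({fset nat}%fset * A)%type.

Definition relabeled_ok (A : sized) (p : relabeled A) : bool :=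
  #|` p.1|%fset == size_of p.2.

(* The label sets are pairwise disjoint, with union {1, ..., n}. *)
Definition label_split (Ls : seq {fset nat}%fset) (n : nat) : bool :=
  perm_eq (flatten [seq enum_fset L | L <- Ls]) (iota 1 n).

Definition well_labeled (A : sized) (s : seq (relabeled A)) : bool :=
  all (@relabeled_ok A) s &&
  label_split [seq p.1 | p <- s] (\sum_(p <- s) size_of p.2).

Definition lprod (A B : sized) : sized :=
  @Sized {p : relabeled A * relabeled B |
           [&& relabeled_ok p.1, relabeled_ok p.2 &
               label_split [:: p.1.1; p.2.1] (size_of p.1.2 + size_of p.2.2)]}
    (fun p => size_of (val p).1.2 + size_of (val p).2.2).

Definition lseq (k : nat) (A : sized) : sized :=
  @Sized {s : seq (relabeled A) | (k <= size s) && well_labeled s}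
    (fun s => \sum_(p <- val s) size_of p.2).

Definition lset (k : nat) (A : sized) : sized :=
  @Sized {S : {fset relabeled A}%fset |
           (k <= #|` S|%fset) && well_labeled (enum_fset S)}
    (fun S => \sum_(p <- enum_fset (val S)) size_of p.2).

Definition cprod (s : setting) : sized -> sized -> sized :=
  if s is Labeled then lprod else uprod.

Definition set_ge (s : setting) : nat -> sized -> sized :=
  if s is Labeled then lset else uset.

Definition seq_ge (s : setting) : nat -> sized -> sized :=
  if s is Labeled then lseq else useq.

Section Graphs.
Variables (T : finType) (e : rel T).

Definition simple_graph : bool :=
  [forall x, ~~ e x x] && [forall x, forall y, e x y == e y x].

Definition connected_graph : bool := [forall x, forall y, connect e x y].

(* (V1, V2) is a split of the subgraph induced by V. *)
Definition is_split (V V1 V2 : {set T}) : bool :=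
  [&& V1 :|: V2 == V, V1 :&: V2 == set0, 2 <= #|V1|, 2 <= #|V2| &
   [forall x in V1, forall y in V2,
      [exists y' in V2, e x y'] && [exists x' in V1, e x' y] ==> e x y]].

Definition distance_hereditary : bool :=
  [forall V : {set T}, (4 <= #|V|) ==>
     [exists V1 : {set T}, exists V2 : {set T}, is_split V V1 V2]].

End Graphs.

(* An adjacency relation, as a set of ordered pairs, together with a root. *)
Definition rooted (n : nat) := ({set 'I_n * 'I_n} * 'I_n)%type.

Definition adj n (g : rooted n) : rel 'I_n := fun x y => (x, y) \in g.1.

Definition rooted_dh n (g : rooted n) : bool :=
  [&& simple_graph (adj g), connected_graph (adj g) &
      distance_hereditary (adj g)].

Definition rooted_iso n (g h : rooted n) : bool :=
  [exists p : {perm 'I_n},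
     (p g.2 == h.2) && [forall x, forall y, adj g x y == adj h (p x) (p y)]].

Definition labeled_dh : sized :=
  @Sized {n : nat & {g : rooted n | rooted_dh g}} (fun u => tag u).

(* The objects of size n are the isomorphism classes of rooted graphs. *)
Definition unlabeled_dh : sized :=
  @Sized {n : nat & {C : {set rooted n} |
            C \in equivalence_partition (@rooted_iso n)
                    [set g | rooted_dh g]}}
    (fun u => tag u).

Definition rooted_dh_class (s : setting) : sized :=
  if s is Labeled then labeled_dh else unlabeled_dh.

Definition dh_system (s : setting) (D K SC SX : comb_class) : Prop :=
  [/\ no_size0 K, no_size0 SC & no_size0 SX] /\
  [/\ class_iso D (cprod s catom (csum (csum K SC) SX)),
      class_iso K (set_ge s 2 (csum (csum catom SC) SX)),
      class_iso SC (set_ge s 2 (csum (csum catom K) SX)) &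
      class_iso SX (seq_ge s 2 (csum (csum catom K) SC))].

(* Main.v *)
(** Delete the root r of a connected graph, keep the set X of its neighbours, and
    view the pair (H, X) as a piece.  Pieces (A, X_A) and (B, X_B) are joined in
    three ways: the product X_A x X_B is added as edges and X = X_A + X_B
    (clique); no edge is added and X = X_A + X_B (star entered at its centre);
    X_A x X_B is added and X = X_A (star entered at an extremity).  The first two
    operations are associative and commutative, and the third satisfies
    a > (b > c) <> (a > b) > c = a > (b + c), so iterating it to the right gives
    sequences.  A normal form is thus a tree whose nodes have at least two children,
    none of the kind of its parent.

    A graph built in this way is distance-hereditary, because any set of
    vertices containing two leaves contains two leaves {u, v} whose cut is a
    split.  Conversely, replacing one side of a split by a single vertex
    and inducting on the size, one cuts a connected distance-hereditary graph
    minus its root into two pieces.  Normal forms are unique because a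
    connected piece is decomposable for at most one of the three operations, and
    the pieces indecomposable for that operation are determined by H and X.
    Finally the unlabeled objects are the trees up to forgetting the leaves:
    two graphs are isomorphic iff their trees have the same canonical shape. *)

From mathcomp Require Import finmap multiset all_boot all_fingroup.
Require Import Defs.
From Stdlib Require Import ClassicalEpsilon.

Set Implicit Arguments.
Unset Strict Implicit.
Unset Printing Implicit Defensive.

(** The obstacle is that [Set] takes unordered arguments while a tree lists its children. Trees are
    therefore compared through the pieces they encode, and sorting the children of the symmetric
    nodes chooses one tree per piece. The order is arbitrary and relabeling does not respect it, so
    every change of labels is followed by a new sort. The type of leaf labels is a parameter:
    natural numbers give the labeled objects and a one-element type the unlabeled ones, so that one
    family of trees solves the system in both settings. A split alone does not cut a graph into two
    pieces as seen from the root. What is needed is a partition of the other vertices into two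
    parts, each having a cut of rank at most 1 with everything else, and contraction serves to find
    it. The system determines its solution because a component of a structure with at least two
    components of positive size is smaller than the whole. The first equation produces nothing of
    size 1 or 2, so the solution exhibited keeps only the graphs with at least 3 vertices. *)

Notation tree := GenTree.tree.
Notation Leaf := GenTree.Leaf.
Notation Node := GenTree.Node.

(** * Trees and the graphs they encode *)

(* Nodes of kind 0, 1, 2 are the objects of K, S_C, S_X; a leaf gets kind 3. *)
Section Trees.
Variable T : countType.
Implicit Types (t c a b : tree T) (cs : seq (tree T)) (k : nat) (x y : T).

Fixpoint leaves t : seq T :=
  match t with
  | Leaf x => [:: x]
  | Node _ cs => flatten [seq leaves c | c <- cs]
  end.

Definition kind t := if t is Node k _ then k else 3.

Fixpoint wf t :=
  match t with
  | Leaf _ => true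
  | Node k cs => [&& k < 3, 1 < size cs, all (fun c => kind c != k) cs & all wf cs]
  end.

(* [acc t] is the set X of vertices adjacent to the root, [edge t] the graph H. *)
Fixpoint acc t y : bool :=
  match t with
  | Leaf x => y == x
  | Node k cs =>
    foldr (fun c rest => acc c y || (k != 2) && rest) false cs
  end.

Fixpoint edge t x y : bool :=
  match t with
  | Leaf _ => false
  | Node k cs =>
    (fix edges cs := if cs is c :: cs' then
       [|| edge c x y, edges cs' |
           (k != 1) && (acc c x && acc (Node k cs') y ||
                        acc c y && acc (Node k cs') x)]
     else false) cs
  end.

Lemma leaves_cons k c cs : leaves (Node k (c :: cs)) = leaves c ++ leaves (Node k cs).
Proof. by []. Qed.

Lemma acc_cons k c cs y :
  acc (Node k (c :: cs)) y = acc c y || (k != 2) && acc (Node k cs) y.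
Proof. by []. Qed.

Lemma edge_cons k c cs x y :
  edge (Node k (c :: cs)) x y = [|| edge c x y, edge (Node k cs) x y |
    (k != 1) && (acc c x && acc (Node k cs) y || acc c y && acc (Node k cs) x)].
Proof. by []. Qed.

Lemma acc1 k c y : acc (Node k [:: c]) y = acc c y.
Proof. by rewrite /= andbF orbF. Qed.

Lemma edge1 k c x y : edge (Node k [:: c]) x y = edge c x y.
Proof. by rewrite edge_cons /= !andbF orbF. Qed.

Lemma leaves1 k c : leaves (Node k [:: c]) = leaves c.
Proof. by rewrite /= cats0. Qed.

Lemma acc_leaf x y : acc (Leaf x) y = (y == x). Proof. by []. Qed.

Lemma edge_leaf z x y : edge (Leaf z) x y = false. Proof. by []. Qed.

Lemma acc0 k y : acc (Node k [::]) y = false. Proof. by []. Qed.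

Lemma edge0 k x y : edge (Node k [::]) x y = false. Proof. by []. Qed.

Arguments acc : simpl never.
Arguments edge : simpl never.

(** A node with children [c :: cs] is the join of [c] with the node of children [cs], which need not
    be well formed. Induction one child at a time thus passes through nodes with one child or
    none. *)
Lemma tree_ind_cons (P : tree T -> Prop) :
  (forall x, P (Leaf x)) -> (forall k, P (Node k [::])) ->
  (forall k c cs, P c -> P (Node k cs) -> P (Node k (c :: cs))) ->
  forall t, P t.
Proof.
move=> PL P0 PS; elim=> // k; elim=> [|c cs IH] //= [Pc Pcs].
by apply: PS => //; apply: IH.
Qed.

Lemma tree_ind_mem (P : tree T -> Prop) :
  (forall x, P (Leaf x)) ->
  (forall k cs, (forall c, c \in cs -> P c) -> P (Node k cs)) ->
  forall t, P t.
Proof.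
move=> PL PN; elim=> // k cs H; apply: PN.
elim: cs H => [|c cs IH] //= [Pc /IH Pcs] d.
by rewrite inE => /predU1P[->|/Pcs].
Qed.

Lemma acc_leaves t x : acc t x -> x \in leaves t.
Proof.
elim/tree_ind_cons: t => [y|//|k c cs IHc IH]; first by rewrite acc_leaf inE.
rewrite acc_cons leaves_cons mem_cat => /orP[/IHc ->//|/andP[_ /IH ->]].
by rewrite orbT.
Qed.

Lemma edge_sym t x y : edge t x y = edge t y x.
Proof.
elim/tree_ind_cons: t => [//|//|k c cs IHc IH].
by rewrite !edge_cons IHc IH; congr [|| _, _ | _ && _]; rewrite orbC.
Qed.

Lemma edge_leavesl t x y : edge t x y -> x \in leaves t.
Proof.
elim/tree_ind_cons: t => [//|//|k c cs IHc IH].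
rewrite edge_cons leaves_cons mem_cat => /or3P[/IHc ->//|/IH ->|].
  by rewrite orbT.
by case/andP=> _ /orP[]/andP[] => [/acc_leaves ->|_ /acc_leaves ->] //; rewrite orbT.
Qed.

Lemma edge_leavesr t x y : edge t x y -> y \in leaves t.
Proof. by rewrite edge_sym; apply: edge_leavesl. Qed.

(** Two trees are identified when they encode the same piece. *)
Definition eqv t t' :=
  [/\ perm_eq (leaves t) (leaves t'), acc t =1 acc t' & edge t =2 edge t'].

Lemma eqv_refl t : eqv t t. Proof. by split. Qed.

Lemma eqv_sym t t' : eqv t t' -> eqv t' t.
Proof. by case=> *; split=> [|x|x y]; rewrite 1?perm_sym. Qed.

Lemma eqv_trans t2 t1 t3 : eqv t1 t2 -> eqv t2 t3 -> eqv t1 t3.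
Proof.
case=> p1 a1 e1 [p2 a2 e2]; split=> [|x|x y].
- exact: perm_trans p1 p2.
- by rewrite a1.
- by rewrite e1.
Qed.

Lemma eqv_cons k c c' cs cs' : eqv c c' -> eqv (Node k cs) (Node k cs') ->
  eqv (Node k (c :: cs)) (Node k (c' :: cs')).
Proof.
case=> p1 a1 e1 [p2 a2 e2]; split=> [|x|x y].
- by rewrite !leaves_cons perm_cat.
- by rewrite !acc_cons a1 a2.
- by rewrite !edge_cons e1 e2 !a1 !a2.
Qed.

Lemma eqv1 k c : eqv (Node k [:: c]) c.
Proof. by split=> [|x|x y]; rewrite ?leaves1 ?acc1 ?edge1. Qed.

(** For [k = 2] only the first child gives accessible vertices, so the order of the children matters
    there. *)
Lemma eqv_swap k c d cs : k != 2 ->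
  eqv (Node k [:: c, d & cs]) (Node k [:: d, c & cs]).
Proof.
move=> k2; split=> [|x|x y].
- by rewrite !leaves_cons perm_catCA.
- by rewrite !acc_cons k2 /= orbCA.
- rewrite !edge_cons !acc_cons k2 /=; move: (Node k cs) => b.
  case: (k != 1); rewrite /= ?orbF; last by rewrite orbCA.
  case: (edge c x y); rewrite /= ?orbT //; case: (edge d x y); rewrite /= ?orbT //.
  case: (edge b x y); rewrite /= ?orbT //.
  by case: (acc c x); case: (acc c y); case: (acc d x); case: (acc d y);
    case: (acc b x); case: (acc b y).
Qed.

Lemma eqv_move k c s1 s2 : k != 2 ->
  eqv (Node k (s1 ++ c :: s2)) (Node k (c :: s1 ++ s2)).
Proof.
move=> k2; elim: s1 => [|d s1 IH]; first exact: eqv_refl.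
by apply: eqv_trans (eqv_swap _ _ _ k2); apply: eqv_cons IH; apply: eqv_refl.
Qed.

Lemma eqv_perm k cs cs' : k != 2 -> perm_eq cs cs' ->
  eqv (Node k cs) (Node k cs').
Proof.
move=> k2; elim: cs cs' => [|c cs IH] cs' pcs.
  by move: pcs; rewrite perm_sym => /perm_nilP->; apply: eqv_refl.
have cin : c \in cs' by rewrite -(perm_mem pcs) mem_head.
case/splitPr: cs' / cin pcs => s1 s2 pcs.
apply: eqv_trans (eqv_sym (eqv_move _ _ _ k2)).
apply: eqv_cons (eqv_refl _) (IH _ _).
by rewrite -(perm_cons c) (perm_trans pcs) // perm_catC /= perm_cons perm_catC.
Qed.

Lemma eqv_flat k a cs ds : k != 2 -> cs != [::] ->
  eqv a (Node k cs) -> eqv (Node k (cs ++ ds)) (Node k (a :: ds)).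
Proof.
move=> k2; case: cs a => // c cs a _ eac.
apply: eqv_trans (eqv_cons (eqv_sym eac) (eqv_refl _)).
elim: cs c {a eac} => [|d cs IH] c.
  by apply: eqv_cons (eqv_refl _); apply/eqv_sym/eqv1.
apply: eqv_trans (eqv_cons (eqv_refl c) (IH d)) _ => {IH}.
set b := Node k (d :: cs); split=> [|x|x y].
- by rewrite [leaves (Node k (c :: _))]leaves_cons !(leaves_cons _ _ ds) leaves_cons catA.
- by rewrite (acc_cons _ c) !(acc_cons _ _ ds) (acc_cons _ c) k2 orbA.
rewrite (edge_cons _ c) !(edge_cons _ _ ds) !(acc_cons _ _ ds) (edge_cons _ c).
rewrite !(acc_cons _ c) -/b k2 /=; move: b (Node k ds) => b e.
case: (k != 1); rewrite /= ?orbF ?orbA //.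
case: (edge c x y); rewrite /= ?orbT //; case: (edge b x y); rewrite /= ?orbT //.
case: (edge e x y); rewrite /= ?orbT //.
by case: (acc c x); case: (acc c y); case: (acc e x); case: (acc e y);
    case: (acc b x); case: (acc b y).
Qed.

Lemma wf_leaves t : wf t -> 0 < size (leaves t).
Proof.
elim/tree_ind_mem: t => // k [|c cs] IH /=; first by rewrite andbF.
case/and4P=> _ _ _ /andP[wc _].
by rewrite size_cat addn_gt0 IH // mem_head.
Qed.

Lemma wf_node_leaves k cs : wf (Node k cs) -> 1 < size (leaves (Node k cs)).
Proof.
case: cs => [|c [|d cs]] /=; rewrite ?andbF // => /and3P[_ _ /and3P[wc wd _]].
by rewrite !size_cat addnA ltn_addr // -add1n leq_add // wf_leaves.
Qed.

Definition kids k t := if t is Node k' cs then if k' == k then cs else [:: t] else [:: t].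

Lemma kidsP k t : k < 3 -> wf t ->
  [/\ kids k t != [::], all wf (kids k t), all (fun c => kind c != k) (kids k t) &
      eqv t (Node k (kids k t))].
Proof.
move=> k3; case: t => [x|k' cs] wt /=.
  by split=> //; [rewrite /= gtn_eqF | apply/eqv_sym/eqv1].
have [kk'|kk'] := eqVneq k' k.
  rewrite {k'}kk' in wt *; case/and4P: wt => _ s2 ak aw.
  by split=> //; case: (cs) s2.
by split; [| rewrite all_seq1 | rewrite all_seq1 | apply/eqv_sym/eqv1].
Qed.

(** By associativity, operands that are themselves joins of kind [k] are replaced by their children.
    The kind of the result is recorded because such a join later becomes a child of a node of kind
    2. *)
Lemma join_wf k a b : k < 2 -> wf a -> wf b ->
  exists t, [/\ wf t, kind t = k & eqv t (Node k [:: a; b])].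
Proof.
move=> k2 wa wb; have k3 : k < 3 by apply: leq_trans k2 _.
have kn2 : k != 2 by rewrite ltn_eqF.
have [na wka kka ea] := kidsP k3 wa; have [nb wkb kkb eb] := kidsP k3 wb.
exists (Node k (kids k a ++ kids k b)); split=> //.
  rewrite /= k3 !all_cat wka wkb kka kkb !andbT size_cat.
  by case: (kids k a) na => // ? ? _; case: (kids k b) nb => // ? ? _; rewrite addSn addnS.
apply: eqv_trans (eqv_flat _ kn2 na ea) _; apply: eqv_cons (eqv_refl _) _.
exact: eqv_trans (eqv_sym eb) (eqv_sym (eqv1 _ _)).
Qed.

Lemma node_wf k a b : k < 3 -> wf a -> wf b ->
  exists2 t, wf t & eqv t (Node k [:: a; b]).
Proof.
move=> k3 wa wb; case: (ltngtP k 2) => [k2|k2|->{k k3}].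
- by have [t [wt _ et]] := join_wf k2 wa wb; exists t.
- by rewrite ltnNge k2 in k3.
have [_ wkb kkb eb] := kidsP (isT : 2 < 3) wb.
have [ka|ka] := eqVneq (kind a) 2; last first.
  exists (Node 2 (a :: kids 2 b)).
    by rewrite /= wa ka wkb kkb; case: (kids 2 b) (eb) => //= -[/perm_size/=];
       case: (leaves b) (wf_leaves wb).
  apply: eqv_cons (eqv_refl _) _.
  exact: eqv_trans (eqv_sym eb) (eqv_sym (eqv1 _ _)).
case: a ka wa => //= k [|c cs] -> //= /and4P[cs1 /andP[kc kcs] wc wcs].
(* Removing the first child may leave a single one, which is then the remainder itself. *)
have [a' wa' ea'] : exists2 a', wf a' & eqv a' (Node 2 cs).
  case: cs cs1 kcs wcs => [|d [|e cs]] //= _ kcs wcs.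
    by exists d; [case/andP: wcs | apply/eqv_sym/eqv1].
  by exists (Node 2 [:: d, e & cs]); [rewrite /= kcs wcs | apply: eqv_refl].
(* With [>] for kind 2 and [+] for kind 1, [(c > a') > b] encodes the same piece as [c > (a' + b)],
   whose second operand has kind 1 and so is a legal child. *)
have [t [wt kt et]] := join_wf (isT : 1 < 2) wa' wb.
exists (Node 2 [:: c; t]); first by rewrite /= kc kt wc wt.
apply: eqv_trans (eqv_cons (eqv_refl c) (eqv_cons et (eqv_refl _))) _.
case: ea' => pa aa ea; split=> [|x|x y].
- rewrite !leaves_cons /= !cats0 -catA perm_cat2l; apply: (perm_cat pa); exact: perm_refl.
- by rewrite !acc_cons /= !orbF.
rewrite !edge_cons !acc_cons !ea !aa !acc0 !edge0 /= !andbF !orbF.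
move: (Node 2 cs) => d.
case: (edge c x y); rewrite /= ?orbT //; case: (edge b x y); rewrite /= ?orbT //.
case: (edge d x y); rewrite /= ?orbT //.
by case: (acc c x); case: (acc c y); case: (acc d x); case: (acc d y);
    case: (acc b x); case: (acc b y).
Qed.

End Trees.

Arguments acc {T} : simpl never.
Arguments edge {T} : simpl never.
Arguments wf {T}.
Arguments leaves {T}.
Arguments kind {T}.

(** * Uniqueness of normal forms *)

Section Uniqueness.
Variable T : countType.
Implicit Types (t c a b : tree T) (cs : seq (tree T)) (k : nat) (x y : T).

(** Unlike [wf], this property passes to the tail of a list of children as long as one child
    remains. *)
Fixpoint nonempty t :=
  if t is Node _ cs then (cs != [::]) && all nonempty cs else true.

Lemma wf_nonempty t : wf t -> nonempty t.
Proof.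
elim/tree_ind_mem: t => // k cs IH /= /and4P[_ s2 _ /allP aw].
rewrite -size_eq0 -lt0n (ltn_trans _ s2) //=.
by apply/allP=> c cin; apply/IH/aw.
Qed.

(* Connectedness of the graph obtained by attaching a root to the accessible vertices. *)
Lemma tree_conn t (S : pred T) : nonempty t -> (exists2 x, x \in leaves t & S x) ->
  (exists2 x, acc t x & S x) \/ (exists x y, [/\ edge t x y, S x & ~~ S y]).
Proof.
elim/tree_ind_cons: t S => [x|//|k c cs IHc IH] S.
  by move=> _ [y]; rewrite inE => /eqP-> Sx; left; exists x; rewrite // acc_leaf.
move=> /= /andP[nc ncs] [x]; rewrite mem_cat => /orP[xc|xcs] Sx.
  have [[y ay Sy]|[y [z [e Sy Sz]]]] := IHc S nc (ex_intro2 _ _ x xc Sx).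
    by left; exists y; rewrite // acc_cons ay.
  by right; exists y, z; rewrite edge_cons e.
have {}ncs : nonempty (Node k cs) by rewrite /= ncs andbT; case: (cs) xcs.
have [[y ay Sy]|[y [z [e Sy Sz]]]] := IH S ncs (ex_intro2 _ _ x xcs Sx); last first.
  by right; exists y, z; rewrite edge_cons e orbT.
(* For [k = 2] the tail reaches the root only through the head: an accessible vertex [z] of the head
   is adjacent to [y], so either [z] lies in [S] or this edge leaves [S]. *)
have [k2|k2] := eqVneq k 2; last by left; exists y; rewrite // acc_cons ay k2 orbT.
have [z az] : exists z, acc c z.
  have : exists2 x, x \in leaves c & predT x.
    elim/tree_ind_cons: (c) nc => [u|//|k' d ds IHd _] /=; first by exists u; rewrite ?inE.
    by case/andP=> /IHd[u uin] _ _; exists u; rewrite // mem_cat uin.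
  by case/(IHc predT nc) => [[z]|[? [? [_ _]]]] //; exists z.
have [Sz|Sz] := boolP (S z); first by left; exists z; rewrite // acc_cons az.
by right; exists y, z; rewrite edge_cons az ay k2 !orbT.
Qed.

(** Connectedness applied to the set of all vertices, which no edge can leave. *)
Lemma nonempty_acc t : nonempty t -> exists x, acc t x.
Proof.
move=> nt; have : exists2 x, x \in leaves t & predT x.
  elim/tree_ind_cons: (t) nt => [u|//|k' d ds IHd _] /=; first by exists u; rewrite ?inE.
  by case/andP=> /IHd[u uin] _ _; exists u; rewrite // mem_cat uin.
by case/(tree_conn nt) => [[z]|[? [? [_ _]]]] //; exists z.
Qed.

(** * Reading the two operands off a join with distinct leaves *)

Section Cons.
Variables (k : nat) (c : tree T) (cs : seq (tree T)).
Let t := Node k (c :: cs).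
Let d := Node k cs.
Hypothesis ut : uniq (leaves t).

Lemma head_uniq : uniq (leaves c).
Proof. by move: ut; rewrite leaves_cons cat_uniq => /and3P[]. Qed.

Lemma tail_uniq : uniq (leaves d).
Proof. by move: ut; rewrite leaves_cons cat_uniq => /and3P[]. Qed.

Lemma head_notin_tail x : x \in leaves c -> x \notin leaves d.
Proof.
move: ut; rewrite leaves_cons cat_uniq => /and3P[_ /hasPn H _] xc.
by apply: contraL xc => /H.
Qed.

Lemma tail_notin_head x : x \in leaves d -> x \notin leaves c.
Proof. by apply: contraL => /head_notin_tail. Qed.

Lemma acc_head x : x \in leaves c -> acc t x = acc c x.
Proof.
move=> xc; rewrite acc_cons; case adx: (acc (Node k cs) x); rewrite ?andbF ?orbF //.
by move/acc_leaves: adx; rewrite (negPf (head_notin_tail xc)).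
Qed.

Lemma acc_tail x : x \in leaves d -> acc t x = (k != 2) && acc d x.
Proof.
move=> xc; rewrite acc_cons; case acx: (acc c x) => //.
by move/acc_leaves: acx; rewrite (negPf (tail_notin_head xc)).
Qed.

Lemma edge_head x y : x \in leaves c -> y \in leaves c -> edge t x y = edge c x y.
Proof.
move=> xc yc; rewrite edge_cons; case: (edge c x y) => //=.
case e: (edge (Node k cs) x y).
  by move/edge_leavesl: e; rewrite (negPf (head_notin_tail xc)).
case ax: (acc (Node k cs) x).
  by move/acc_leaves: ax; rewrite (negPf (head_notin_tail xc)).
case ay: (acc (Node k cs) y).
  by move/acc_leaves: ay; rewrite (negPf (head_notin_tail yc)).
by rewrite !andbF.
Qed.

Lemma edge_tail x y : x \in leaves d -> y \in leaves d -> edge t x y = edge d x y.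
Proof.
move=> xc yc; rewrite edge_cons; case e: (edge c x y).
  by move/edge_leavesl: e; rewrite (negPf (tail_notin_head xc)).
case ax: (acc c x).
  by move/acc_leaves: ax; rewrite (negPf (tail_notin_head xc)).
case ay: (acc c y).
  by move/acc_leaves: ay; rewrite (negPf (tail_notin_head yc)).
by rewrite !andbF orbF.
Qed.

Lemma edge_cross x y : x \in leaves c -> y \in leaves d ->
  edge t x y = [&& k != 1, acc c x & acc d y].
Proof.
move=> xc yc; rewrite edge_cons; case e: (edge c x y).
  by move/edge_leavesr: e; rewrite (negPf (tail_notin_head yc)).
case e': (edge (Node k cs) x y).
  by move/edge_leavesl: e'; rewrite (negPf (head_notin_tail xc)).
case ay: (acc c y).
  by move/acc_leaves: ay; rewrite (negPf (tail_notin_head yc)).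
by rewrite /= orbF.
Qed.
End Cons.

(* [t] is the join by operation [k] of the pieces cut out by [A] and its complement;
   [Y] is the accessible set of the complement, needed only for k = 2. *)
Definition decomposable k t := exists A Y : pred T,
  [/\ exists2 x, x \in leaves t & A x,
      exists2 x, x \in leaves t & ~~ A x,
      k = 2 -> forall x, acc t x -> A x &
      forall x y, x \in leaves t -> y \in leaves t -> A x -> ~~ A y ->
        edge t x y = [&& k != 1, acc t x & if k == 0 then acc t y else Y y]].

Lemma eqv_decomposable k t t' : eqv t t' -> decomposable k t -> decomposable k t'.
Proof.
case=> /perm_mem p a e [A [Y [[x xt Ax] [y yt Ay] A2 E]]]; exists A, Y; split.
- by exists x; rewrite -?p.
- by exists y; rewrite -?p.
- by move=> /A2 H z; rewrite -a => /H.
- by move=> u v; rewrite -!p -e -!a; apply: E.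
Qed.

Lemma node_decomposable k c cs : k < 3 -> uniq (leaves (Node k (c :: cs))) ->
  nonempty (Node k (c :: cs)) -> cs != [::] -> decomposable k (Node k (c :: cs)).
Proof.
move=> k3 u nt ncs; exists (mem (leaves c)), (acc (Node k cs)).
have [nc nd] : nonempty c /\ nonempty (Node k cs).
  by move: nt => /= /andP[-> ->]; rewrite ncs.
have [x ax] := nonempty_acc nc; have [y ay] := nonempty_acc nd.
split.
- by exists x; rewrite /= ?mem_cat (acc_leaves ax).
- exists y; first by rewrite leaves_cons mem_cat (acc_leaves ay) orbT.
  exact: (tail_notin_head u (acc_leaves ay)).
- by move=> -> z; rewrite acc_cons orbF => /acc_leaves.
- move=> {x ax y ay} x y _; rewrite leaves_cons mem_cat /= => yt xc yc.
  move: yt; rewrite (negPf yc) => /= yd.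
  rewrite (edge_cross u) // (acc_head u) //.
  by case: (k =P 0) => // k0; rewrite (acc_tail u) // k0.
Qed.

Lemma leaf_indecomposable k x : ~ decomposable k (Leaf x).
Proof.
by case=> A [_ [[y + Ay] [z + /negP Az] _ _]]; rewrite !inE => /eqP ? /eqP ?; subst.
Qed.

(** A decomposition of kind 0 or 1 has accessible vertices on both sides, by connectedness. One of
    kind 2 yields an inaccessible vertex adjacent to all accessible ones, which is incompatible with
    the former. Kinds 0 and 1 exclude each other because the first makes the accessible vertices
    connected and the second separates them. *)
Lemma decomposable_inj t k k' : nonempty t -> k < 3 -> k' < 3 ->
  decomposable k t -> decomposable k' t -> k = k'.
Proof.
move=> nt.
wlog lt_kk' : k k' / k < k'.
  move=> H k3 k'3 d d'; case: (ltngtP k k') => // ltk; first exact: H.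
  by symmetry; apply: H.
have leaf_acc x : acc t x -> x \in leaves t by apply: acc_leaves.
have both j (A Y : pred T) : j < 2 ->
    (exists2 x, x \in leaves t & A x) -> (exists2 x, x \in leaves t & ~~ A x) ->
    (forall x y, x \in leaves t -> y \in leaves t -> A x -> ~~ A y ->
        edge t x y = [&& j != 1, acc t x & if j == 0 then acc t y else Y y]) ->
    (exists2 x, acc t x & A x) /\ (exists2 x, acc t x & ~~ A x).
  move=> j2 exA exB E; split.
    case: (tree_conn nt exA) => [//|[x [y [e Ax Ay]]]]; exists x => //.
    by move: (e); rewrite E ?(edge_leavesl e) ?(edge_leavesr e) // => /and3P[].
  case: (@tree_conn _ (predC A) nt exB) => [//|[x [y [e Ax]]]]; rewrite /= negbK => Ay.
  exists x => //; move: (e); rewrite edge_sym E ?(edge_leavesl e) ?(edge_leavesr e) //.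
  by case/and3P=> j1 _; case: j j1 j2 {E} => [|[]].
move=> k3 k'3 [A [Y [exA exB A2 E]]] [A' [Y' [exA' exB' A2' E']]]; exfalso.
have k2 : k < 2 by apply: leq_trans lt_kk' _.
have [[a aa Aa] [b ab Ab]] := both k A Y k2 exA exB E.
have [k'2|k'2] := eqVneq k' 2.
  (* No accessible vertex lies outside [A'], so some edge leads from there into [A']; its outer end
     then sees the whole accessible set. *)
  have [y yt [Ay ey]] : exists2 y, y \in leaves t &
      ~~ A' y /\ forall x, acc t x -> edge t x y.
    have [[y ay]|[y [z [e Ay Az]]]] := @tree_conn _ (predC A') nt exB'.
      by rewrite /= A2'.
    exists y; first exact: edge_leavesl e.
    split=> // x ax; move: Az; rewrite /= negbK => Az.
    have yt := edge_leavesl e; have zt := edge_leavesr e; have xt := leaf_acc _ ax.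
    have A'x := A2' k'2 _ ax.
    by move: e; rewrite edge_sym !E' // k'2 ax => /= /andP[_].
  have := ey b ab; have := ey a aa; case Ay' : (A y).
    rewrite (edge_sym t b) (E y b) ?Ay' // ?(leaf_acc b) // => _ /and3P[_ acy _].
    by rewrite (A2' k'2 _ acy) in Ay.
  rewrite (E a y) ?Ay' // ?(leaf_acc a) // => /and3P[k1 _].
  case: eqP => [_ acy _|]; last by case: (k) k1 k2 => [|[]].
  by rewrite (A2' k'2 _ acy) in Ay.
have [k0 k'1] : k = 0 /\ k' = 1.
  by move: lt_kk' k'3 k'2 k2; case: (k') => [|[|[]]] //; case: (k) => [|[]].
have k'lt2 : k' < 2 by rewrite k'1.
have [[a' aa' Aa'] [b' ab' Ab']] := both k' A' Y' k'lt2 exA' exB' E'.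
(* Accessible vertices on opposite sides of [A] are adjacent, and no edge crosses [A']. As [A] has
   accessible vertices on both sides, [A'] is constant on the accessible vertices, although it
   separates [a'] from [b']. *)
have same x y : acc t x -> acc t y -> A x -> ~~ A y -> A' x = A' y.
  move=> ax ay Ax Ay; have xt := leaf_acc _ ax; have yt := leaf_acc _ ay.
  have e : edge t x y by rewrite E // k0 ax ay.
  case A'x: (A' x); case A'y: (A' y) => //.
    by move: e; rewrite E' ?A'x ?A'y // k'1.
  by move: e; rewrite edge_sym E' ?A'x ?A'y // k'1.
case Aa1: (A a'); case Ab1: (A b').
- by move: Ab'; rewrite (same b' b) ?Ab1 // -(same a' b) ?Aa1 // Aa'.
- by move: Ab'; rewrite -(same a' b') ?Aa1 ?Ab1 // Aa'.
- by move: Ab'; rewrite (same b' a') ?Aa1 ?Ab1 // Aa'.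
- by move: Ab'; rewrite -(same a b') ?Ab1 // (same a a') ?Aa1 // Aa'.
Qed.

End Uniqueness.

(** * Canonical representatives up to reordering of children *)

Section Canonical.
Variable T : countType.
Implicit Types (t c a b : tree T) (cs ds : seq (tree T)) (k : nat) (x y : T).

(** An arbitrary total order, read on codes, whose sole purpose is to select one arrangement of the
    children. *)
Definition tree_le t t' := choice.pickle t <= choice.pickle t'.

(* Only the sequence of children of an S_X-node is meaningful as a sequence. *)
Definition arrange k cs := if k < 2 then sort tree_le cs else cs.

Fixpoint canon t :=
  if t is Node k cs then Node k (arrange k [seq canon c | c <- cs]) else t.

Lemma perm_arrange k cs : perm_eq (arrange k cs) cs.
Proof. by rewrite /arrange; case: ifP => _ //; rewrite perm_sort. Qed.

Lemma arrange_perm k cs ds : k < 2 -> perm_eq cs ds -> arrange k cs = arrange k ds.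
Proof.
rewrite /arrange => -> p; apply/perm_sortP => //.
- by move=> t t'; apply: leq_total.
- by move=> t t' t''; apply: leq_trans.
- by move=> t t' /anti_leq/(pcan_inj choice.pickleK).
Qed.

Lemma arrange_id k cs : arrange k (arrange k cs) = arrange k cs.
Proof.
have [k2|k2] := ltnP k 2; last by rewrite /arrange ltnNge k2.
exact/arrange_perm/perm_arrange.
Qed.

Lemma kind_canon t : kind (canon t) = kind t.
Proof. by case: t. Qed.

Lemma wf_canon t : wf (canon t) = wf t.
Proof.
elim/tree_ind_mem: t => //= k cs IH.
rewrite (perm_size (perm_arrange _ _)) size_map; congr [&& _, _, _ & _].
  rewrite (perm_all _ (perm_arrange _ _)) all_map.
  by apply: eq_all => c /=; rewrite kind_canon.
rewrite (perm_all _ (perm_arrange _ _)) all_map.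
by apply: eq_in_all => c /IH.
Qed.

Lemma eqv_map k (f : tree T -> tree T) cs :
  (forall c, c \in cs -> eqv (f c) c) -> eqv (Node k [seq f c | c <- cs]) (Node k cs).
Proof.
elim: cs => [|c cs IH] H; first exact: eqv_refl.
by apply: eqv_cons; [apply: H | apply: IH => d dcs; apply: H]; rewrite inE ?eqxx ?dcs ?orbT.
Qed.

Lemma eqv_canon t : eqv (canon t) t.
Proof.
elim/tree_ind_mem: t => [x|k cs IH]; first exact: eqv_refl.
apply: (@eqv_trans _ (Node k [seq canon c | c <- cs])) (eqv_map _ IH).
rewrite /= /arrange; case: ifP => [k2|_]; last exact: eqv_refl.
by apply: eqv_perm; [case: (k) k2 => [|[]] | rewrite perm_sort].
Qed.

Lemma leaves_canon t : perm_eq (leaves (canon t)) (leaves t).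
Proof. by case: (eqv_canon t). Qed.

Lemma decomposable_node k cs : wf (Node k cs) -> uniq (leaves (Node k cs)) ->
  decomposable k (Node k cs).
Proof.
move=> wt u; have := wf_nonempty wt.
case: cs wt u => [|c [|d cs]] wt u nt; try by move: wt; rewrite /= andbF.
by apply: node_decomposable => //; case/andP: wt.
Qed.

Lemma indecomposable k c : wf c -> uniq (leaves c) -> k < 3 -> kind c != k ->
  ~ decomposable k c.
Proof.
case: c => [x _ _ _ _|k' cs w u k3 /= /eqP]; first exact: leaf_indecomposable.
move=> kk' dk; apply: kk'.
apply: decomposable_inj dk => //; first exact: wf_nonempty.
  by case/andP: w.
exact: decomposable_node.
Qed.

(** A leaf of [c] outside [c'] would let the leaves of [c'] and their complement decompose [c] by
    the operation [k], which the kind of [c] forbids. *)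
Lemma heads_sub k c c' cs cs' x0 :
  uniq (leaves (Node k (c :: cs))) -> uniq (leaves (Node k (c' :: cs'))) ->
  k < 3 -> wf c -> kind c != k ->
  eqv (Node k (c :: cs)) (Node k (c' :: cs')) ->
  x0 \in leaves c -> x0 \in leaves c' -> {subset leaves c <= leaves c'}.
Proof.
move=> u u' k3 wc kc [/perm_mem p a e] x0c x0c' y yc; apply/negPn/negP => yc'.
have sub z : z \in leaves c -> z \in leaves (Node k (c' :: cs')).
  by rewrite -p leaves_cons mem_cat => ->.
apply: (indecomposable wc (head_uniq u) k3 kc).
exists (mem (leaves c')), (acc (Node k cs')); split.
- by exists x0.
- by exists y.
- move=> k2 x ax; have := a x; rewrite (acc_head u) ?(acc_leaves ax) // ax.
  by rewrite acc_cons k2 orbF => /esym/acc_leaves.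
move=> {y yc yc'} x y xc yc /= xc' yc'.
have yd : y \in leaves (Node k cs').
  by move: (sub y yc); rewrite leaves_cons mem_cat (negPf yc').
rewrite -(edge_head u) // e (edge_cross u') // -(acc_head u) // a (acc_head u') //.
by case: (k =P 0) => // k0; rewrite -(acc_head u) // a (acc_tail u') // k0.
Qed.

Lemma eqv_heads k c c' cs cs' x0 :
  uniq (leaves (Node k (c :: cs))) -> uniq (leaves (Node k (c' :: cs'))) ->
  k < 3 -> wf c -> wf c' -> kind c != k -> kind c' != k ->
  eqv (Node k (c :: cs)) (Node k (c' :: cs')) ->
  x0 \in leaves c -> x0 \in leaves c' ->
  eqv c c' /\ eqv (Node k cs) (Node k cs').
Proof.
move=> u u' k3 wc wc' kc kc' ev x0c x0c'.
have cc' : leaves c =i leaves c'.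
  move=> x; apply/idP/idP; first exact: (heads_sub u u' _ _ _ ev x0c).
  exact: (heads_sub u' u _ _ _ (eqv_sym ev) x0c').
case: ev => /perm_mem p a e.
have dd' : leaves (Node k cs) =i leaves (Node k cs').
  move=> x; have := p x; rewrite !leaves_cons !mem_cat cc'.
  case: (boolP (x \in leaves c')) => [xc'|_] //= _.
  by rewrite (negPf (head_notin_tail u' xc')) (negPf (head_notin_tail u _)) ?cc'.
have ac : acc c =1 acc c'.
  move=> x; case: (boolP (x \in leaves c)) => xc.
    by rewrite -(acc_head u) // a (acc_head u') // -cc'.
  by apply/idP/idP => /acc_leaves; rewrite -?cc' (negPf xc).
have ec : edge c =2 edge c'.
  move=> x y; case: (boolP (x \in leaves c)) => xc; last first.
    by apply/idP/idP => /edge_leavesl; rewrite -?cc' (negPf xc).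
  case: (boolP (y \in leaves c)) => yc; last first.
    by apply/idP/idP => /edge_leavesr; rewrite -?cc' (negPf yc).
  by rewrite -(edge_head u) // e (edge_head u') // -cc'.
have ed : edge (Node k cs) =2 edge (Node k cs').
  move=> x y; case: (boolP (x \in leaves (Node k cs))) => xc; last first.
    by apply/idP/idP => /edge_leavesl; rewrite -?dd' (negPf xc).
  case: (boolP (y \in leaves (Node k cs))) => yc; last first.
    by apply/idP/idP => /edge_leavesr; rewrite -?dd' (negPf yc).
  by rewrite -(edge_tail u) // e (edge_tail u') // -dd'.
split; split=> //; try exact: uniq_perm (head_uniq u) (head_uniq u') cc'.
  exact: uniq_perm (tail_uniq u) (tail_uniq u') dd'.
move=> x; case: (boolP (x \in leaves (Node k cs))) => xc; last first.
  by apply/idP/idP => /acc_leaves; rewrite -?dd' (negPf xc).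
have [k2|k2] := eqVneq k 2; last first.
  by have := a x; rewrite (acc_tail u) // (acc_tail u') -?dd' // k2.
(* For [k = 2] the accessible set of the tail is hidden from the root. It is recovered as the
   neighbourhood in the tail of an accessible vertex of the head. *)
have [z az] := nonempty_acc (wf_nonempty wc).
have zc := acc_leaves az.
by have := e z x; rewrite (edge_cross u) // (edge_cross u') -?cc' -?dd' // -ac az k2.
Qed.

Lemma kids_unique k cs cs' : k < 3 ->
  (forall c, c \in cs -> forall c', wf c' -> uniq (leaves c) -> uniq (leaves c') ->
     eqv c c' -> canon c = canon c') ->
  all wf cs -> all wf cs' ->
  all (fun c => kind c != k) cs -> all (fun c => kind c != k) cs' ->
  uniq (leaves (Node k cs)) -> uniq (leaves (Node k cs')) ->
  eqv (Node k cs) (Node k cs') ->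
  arrange k [seq canon c | c <- cs] = arrange k [seq canon c | c <- cs'].
Proof.
move=> k3 IHc w w' ka ka' u u' ev.
suff : if k == 2 then [seq canon c | c <- cs] = [seq canon c | c <- cs']
       else perm_eq [seq canon c | c <- cs] [seq canon c | c <- cs'].
  have [->|k2 p] := eqVneq k 2; first by move->.
  by apply: arrange_perm => //; case: (k) k2 k3 => [|[|[]]].
elim: cs cs' IHc w w' ka ka' u u' ev => [|c cs IH] cs' IHc w w' ka ka' u u' ev.
  case: cs' ev w' {ka' u'} => [_ _|c' cs' [/perm_size/= H _ _] /andP[w' _]]; first by case: ifP.
  by have := wf_leaves w'; move: H; rewrite size_cat; case: (leaves c').
(* Children are matched through a leaf: the child of [cs'] containing [x0] must be equivalent to
   [c]. The accessibility of [x0] counts for [k = 2], where it forces that child to come first. *)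
have [x0 ax0] := nonempty_acc (wf_nonempty (proj1 (andP w))).
have x0c := acc_leaves ax0.
have [wc wcs] := andP w; have [kc kcs] := andP ka.
have main c' ds : c' \in cs' -> all wf ds -> all (fun c => kind c != k) ds ->
    uniq (leaves (Node k (c' :: ds))) ->
    eqv (Node k (c :: cs)) (Node k (c' :: ds)) -> x0 \in leaves c' ->
    canon c = canon c' /\ if k == 2 then [seq canon c | c <- cs] = [seq canon c | c <- ds]
       else perm_eq [seq canon c | c <- cs] [seq canon c | c <- ds].
  move=> c'in wds kds uds evd x0c'.
  have wc' := allP w' _ c'in; have kc' := allP ka' _ c'in.
  have [ec ed] := eqv_heads u uds k3 wc wc' kc kc' evd x0c x0c'; split.
    by apply: IHc ec => //; [apply: mem_head | exact: head_uniq u | exact: head_uniq uds].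
  apply: (IH ds) => //; [|exact: tail_uniq u | exact: tail_uniq uds].
  by move=> d dcs; apply: IHc; rewrite inE dcs orbT.
have [k2|k2] := eqVneq k 2.
  have : acc (Node k cs') x0.
    by case: ev => _ <- _; rewrite acc_cons ax0.
  case: cs' ev w' ka' u' {IHc} main => // c' cs' ev w' ka' u' main.
  rewrite acc_cons k2 orbF => /acc_leaves x0c'.
  case/andP: w' => wc' wcs'; case/andP: ka' => kc' kcs'.
  have [|||||| ecc'] := main c' cs' => //; first exact: mem_head.
  by rewrite k2 /= ecc' => ->.
have : x0 \in leaves (Node k cs').
  by case: ev => /perm_mem <- _ _; rewrite leaves_cons mem_cat x0c.
case/flattenP=> s /mapP[c' c'in ->{s}] x0c'.
have := c'in; case/splitPr: cs' / c'in main w' ka' u' ev => s1 s2 main w' ka' u' ev c'in.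
have ev' := eqv_move c' s1 s2 k2.
have pp : perm_eq (s1 ++ c' :: s2) (c' :: s1 ++ s2).
  by rewrite perm_catC /= perm_cons perm_catC.
have [|||||] := main c' (s1 ++ s2) c'in => //.
- by move: w'; rewrite (perm_all _ pp) => /andP[].
- by move: ka'; rewrite (perm_all _ pp) => /andP[].
- by case: ev' => /perm_uniq <-.
- exact: eqv_trans ev ev'.
rewrite (negPf k2) => ecc' pc /=; rewrite ecc'.
by rewrite perm_sym (perm_trans (perm_map _ pp)) //= perm_cons perm_sym.
Qed.

Theorem canon_unique t t' : wf t -> wf t' -> uniq (leaves t) -> uniq (leaves t') ->
  eqv t t' -> canon t = canon t'.
Proof.
elim/tree_ind_mem: t t' => [x|k cs IH] [x'|k' cs'] w w' u u' ev.
- by case: ev => /perm_mem/(_ x); rewrite !inE eqxx => /esym/eqP->.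
- by have := wf_node_leaves w'; case: ev => /perm_size <-.
- by have := wf_node_leaves w; case: ev => /perm_size ->.
have k3 : k < 3 by case/andP: w.
have kk' : k = k'.
  apply: (decomposable_inj (wf_nonempty w')) => //; first by case/andP: w'.
    exact: eqv_decomposable ev (decomposable_node w u).
  exact: decomposable_node w' u'.
rewrite -{k'}kk' in w' u' ev *.
case/and4P: w => _ _ ka wa; case/and4P: w' => _ _ ka' wa' /=; congr Node.
apply: kids_unique => // c cin c' wc'; apply: IH => //; exact: (allP wa).
Qed.

End Canonical.

(** * Relabeling of leaves, and shapes *)

Section Relabeling.
Variables T T' : countType.
Implicit Types (f : T -> T') (t : tree T).

Fixpoint tmap f t : tree T' :=
  match t with
  | Leaf x => Leaf (f x)
  | Node k cs => Node k [seq tmap f c | c <- cs]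
  end.

Lemma leaves_tmap f t : leaves (tmap f t) = [seq f x | x <- leaves t].
Proof.
elim/tree_ind_cons: t => // k c cs IHc IH.
by rewrite [tmap _ _]/= !leaves_cons map_cat IHc -IH.
Qed.

Lemma kind_tmap f t : kind (tmap f t) = kind t.
Proof. by case: t. Qed.

Lemma wf_tmap f t : wf (tmap f t) = wf t.
Proof.
elim/tree_ind_mem: t => //= k cs IH; rewrite size_map !all_map.
congr [&& _, _, _ & _]; last exact: eq_in_all.
by apply: eq_all => c /=; rewrite kind_tmap.
Qed.

Lemma acc_tmap f t x : injective f -> acc (tmap f t) (f x) = acc t x.
Proof.
move=> fI; elim/tree_ind_cons: t => [y|//|k c cs IHc IH].
  by rewrite !acc_leaf inj_eq.
by rewrite [tmap _ _]/= !acc_cons IHc -IH.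
Qed.

Lemma edge_tmap f t x y : injective f -> edge (tmap f t) (f x) (f y) = edge t x y.
Proof.
move=> fI; elim/tree_ind_cons: t => [z|//|k c cs IHc IH].
  by rewrite !edge_leaf.
rewrite [tmap _ _]/= !edge_cons IHc -IH.
by rewrite !(acc_tmap c _ fI) -!(acc_tmap (Node k cs) _ fI).
Qed.

(** The inner sort only permutes children of symmetric nodes, and the outer sort forgets such
    permutations. *)
Lemma canon_tmap f t : canon (tmap f (canon t)) = canon (tmap f t).
Proof.
elim/tree_ind_mem: t => //= k cs IH; congr Node.
have e : [seq canon c | c <- [seq tmap f c | c <- [seq canon c | c <- cs]]] =
         [seq canon c | c <- [seq tmap f c | c <- cs]].
  by rewrite -!map_comp; apply/eq_in_map => c /IH.
have [k2|k2] := ltnP k 2; last by rewrite /arrange ltnNge k2 /= e.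
by rewrite -e; apply: (arrange_perm k2); do 2!apply: perm_map; apply: perm_arrange.
Qed.

(** The image of a canonical tree need not be canonical. Arranging the children of [t] by the order
    of their images gives a tree whose image is sorted. When [f] forgets the labels, this turns
    equal canonical shapes into equal shapes. *)
Lemma tmap_reorder f t : exists2 t1, canon t1 = canon t & tmap f t1 = canon (tmap f t).
Proof.
elim/tree_ind_mem: t => [x|k cs IH]; first by exists (Leaf x).
have [ds e1 e2] : exists2 ds, [seq canon c | c <- ds] = [seq canon c | c <- cs] &
    [seq tmap f c | c <- ds] = [seq canon c | c <- [seq tmap f c | c <- cs]].
  elim: cs IH => [|c cs IHcs] IH; first by exists [::].
  have [|ds e1 e2] := IHcs; first by move=> d din; apply: IH; rewrite inE din orbT.
  have [d d1 d2] := IH c (mem_head _ _).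
  by exists (d :: ds) => /=; rewrite ?d1 ?e1 ?d2 ?e2.
have [k2|k2] := ltnP k 2; last first.
  by exists (Node k ds); rewrite /= /arrange ltnNge k2 /= ?e1 ?e2.
exists (Node k (sort (relpre (tmap f) (@tree_le T')) ds)) => /=.
  congr Node; rewrite -e1; apply: (arrange_perm k2); apply: perm_map.
  by rewrite perm_sort.
by rewrite -sort_map e2 /arrange k2.
Qed.

End Relabeling.

Lemma tmap_comp (T T' T'' : countType) (f : T -> T') (g : T' -> T'') t :
  tmap g (tmap f t) = tmap (g \o f) t.
Proof.
elim/tree_ind_mem: t => //= k cs IH; congr Node.
by rewrite -map_comp; apply/eq_in_map => c /IH.
Qed.

Lemma tmap_id_in (T : countType) (f : T -> T) t : {in leaves t, f =1 id} -> tmap f t = t.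
Proof.
elim/tree_ind_mem: t => [x H|k cs IH H] /=; first by rewrite H ?inE.
congr Node; rewrite -[RHS]map_id; apply/eq_in_map => c cin; apply: IH => // x xc; apply: H.
by apply/flattenP; exists (leaves c) => //; apply: map_f.
Qed.

Lemma canon_id (T : countType) (t : tree T) : canon (canon t) = canon t.
Proof. by have := canon_tmap id t; rewrite !tmap_id_in. Qed.

Notation unlabel := (tmap (fun=> tt)).

Lemma size_leaves_unlabel (T : countType) (t : tree T) : size (leaves (unlabel t)) = size (leaves t).
Proof. by rewrite leaves_tmap size_map. Qed.

(** Equal shapes give corresponding children equally many leaves, so the equality of the leaf lists
    breaks up child by child. *)
Lemma tmap_unlabel (T T' : countType) (p : T -> T') (t : tree T) (t' : tree T') :
  unlabel t = unlabel t' -> [seq p x | x <- leaves t] = leaves t' -> tmap p t = t'.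
Proof.
elim/tree_ind_mem: t t' => [x|k cs IH] [x'|k' cs'] //=; first by move=> _ [->].
move=> e; have <- : k = k' by case: e.
have {e} : [seq unlabel c | c <- cs] = [seq unlabel c | c <- cs'] by case: e.
elim: cs cs' IH => [|c cs IHcs] [|c' cs'] IH //= [ec ecs] /eqP.
rewrite map_cat eqseq_cat; last first.
  by rewrite size_map -size_leaves_unlabel ec size_leaves_unlabel.
case/andP=> /eqP lc /eqP lcs; rewrite (IH c (mem_head _ _) c' ec lc).
have IH' d : d \in cs -> forall t', unlabel d = unlabel t' ->
    [seq p x | x <- leaves d] = leaves t' -> tmap p d = t'.
  by move=> din; apply: IH; rewrite inE din orbT.
by have [->] := IHcs cs' IH' ecs lcs.
Qed.

Lemma unlabel_surj (T : countType) (u : tree unit) (s : seq T) :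
  size s = size (leaves u) -> exists2 t, unlabel t = u & leaves t = s.
Proof.
elim/tree_ind_mem: u s => [[]|k cs IH] s.
  by case: s => [|x []] // _; exists (Leaf x).
move=> ss; suff [ds e1 e2] : exists2 ds, [seq unlabel d | d <- ds] = cs & leaves (Node k ds) = s.
  by exists (Node k ds); rewrite //= e1.
elim: cs s IH ss => [|c cs IHcs] s IH; first by case: s => // _; exists [::].
rewrite leaves_cons size_cat => ss.
have [|t t1 t2] := IH c (mem_head _ _) (take (size (leaves c)) s).
  by rewrite size_takel // ss leq_addr.
have [||ds e1 e2] := IHcs (drop (size (leaves c)) s).
- by move=> d din; apply: IH; rewrite inE din orbT.
- by rewrite size_drop ss addKn.
exists (t :: ds); rewrite ?leaves_cons /= ?t1 ?e1 // t2.
by rewrite -[flatten _]/(leaves (Node k ds)) e2 cat_take_drop.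
Qed.

Arguments canon {T}.

(** * From splits to trees *)

Section SplitToTree.
Variables (T : finType) (e : rel T).
Hypothesis eS : symmetric e.
Implicit Types (A B V W S : {set T}) (r x y : T) (t : tree T).

(* The cut between A and B has rank at most 1: this is the split condition. *)
Definition rank1 A B := forall x x' y y', x \in A -> x' \in A -> y \in B -> y' \in B ->
  e x y -> e x' y' -> e x y'.

Lemma rank1_sym A B : rank1 A B -> rank1 B A.
Proof.
move=> rAB x x' y y' xB x'B yA y'A exy ex'y'.
by rewrite eS; apply: (rAB y' y x' x); rewrite // eS.
Qed.

Lemma rank1_set1 x B : rank1 [set x] B.
Proof. by move=> y y' z z'; rewrite !inE => /eqP-> /eqP->. Qed.

Definition conn W := forall S, S \subset W -> S != set0 -> S != W ->
  exists x y, [/\ x \in S, y \in W, y \notin S & e x y].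

(** Across a cut of rank 1, all outside vertices with a neighbour in [A] have the same neighbours in
    [A]. Hence [r] can stand for the whole other side: an edge leaving [A] may be replaced by one
    with the same end in [A] and other end [r]. *)
Lemma conn_restrict W A r x0 : conn W -> A \subset W -> rank1 A (W :\: A) ->
  r \in W :\: A -> x0 \in A -> e r x0 -> conn (r |: A).
Proof.
move=> cW AW rA /setDP[rW rnA] x0A erx0.
have base S : S \subset r |: A -> S != set0 -> r \notin S ->
    exists x y, [/\ x \in S, y \in r |: A, y \notin S & e x y].
  move=> SA S0 rS; have {}SA : {subset S <= A}.
    move=> x xS; have /setU1P[xr|//] := subsetP SA x xS.
    by rewrite -xr xS in rS.
  have [||x [y [xS yW yS exy]]] := cW S _ S0.
  - by apply/subsetP=> x /SA; apply: (subsetP AW).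
  - by apply: contraNneq rS => ->.
  have [yA|yA] := boolP (y \in A); first by exists x, y; rewrite in_setU1 yA orbT.
  exists x, r; rewrite setU11; split=> //.
  have erx0' : e x0 r by rewrite eS.
  by apply: (rA x x0 y r _ _ _ _ exy erx0') => //; rewrite ?inE ?yA ?rnA //; apply: SA.
move=> S SA S0 SnA; have [rS|] := boolP (r \in S); last exact: base.
have [|||x [y [/setDP[xA xS] yA yS exy]]] := base ((r |: A) :\: S).
- exact: subsetDl.
- by rewrite setD_eq0; apply: contraNN SnA => AS; rewrite eqEsubset SA.
- by rewrite !inE rS.
exists y, x; split=> //; last by rewrite eS.
by move: yS; rewrite in_setD yA andbT negbK.
Qed.

Hypothesis dh : distance_hereditary e.

Lemma dh_split V : 4 <= #|V| -> exists V1 V2,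
  [/\ V1 :|: V2 = V, [disjoint V1 & V2], 2 <= #|V1|, 2 <= #|V2| & rank1 V1 V2].
Proof.
move=> V4; move/forallP: dh => /(_ V); rewrite V4 /= => /existsP[V1 /existsP[V2]].
case/and5P=> /eqP UV IV c1 c2 /'forall_in_forall_inP H; exists V1, V2; split=> //.
  by rewrite -setI_eq0.
move=> x x' y y' xV1 x'V1 yV2 y'V2 exy ex'y'.
apply: (implyP (H x xV1 y' y'V2)); apply/andP; split; apply/exists_inP.
  by exists y.
by exists x'.
Qed.

Definition tripartition W r A B :=
  [/\ A != set0, B != set0, [disjoint A & B], r \notin A :|: B & W = r |: (A :|: B)].

Lemma tripartitionC W r A B : tripartition W r A B -> tripartition W r B A.
Proof. by case=> A0 B0 dAB rAB ->; split; rewrite // 1?disjoint_sym // (setUC B). Qed.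

(** A split gives two parts, one containing [r]. The other is contracted to a vertex [v] having a
    neighbour on the side of [r]; the smaller graph is cut by induction, and [v] is expanded again
    in the part where it lies. *)
Lemma dh_tripartition W r : 3 <= #|W| -> r \in W -> conn W ->
  exists A B, [/\ tripartition W r A B, rank1 A (r |: B) & rank1 B (r |: A)].
Proof.
have [n] := ubnP #|W|; elim: n => // n IH in W r * => Wn W3 rW cW.
have [W4|W4] := ltnP 3 #|W|; last first.
  have : #|W :\ r| == 2.
    by move: W3 W4; rewrite (cardsD1 r W) rW add1n !ltnS eqn_leq => -> ->.
  case/cards2P=> a [b [ab dW]]; exists [set a], [set b].
  have rab : r \notin [set a] :|: [set b] by rewrite -dW !inE eqxx.
  split; try exact: rank1_set1; split=> //.
  - by apply/set0Pn; exists a; rewrite inE.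
  - by apply/set0Pn; exists b; rewrite inE.
  - by rewrite disjoints1 inE.
  - by rewrite -dW setD1K.
have [V1 [V2 [[rV1 UV dV c1 c2] rk]]] : exists V1 V2,
  [/\ r \in V1, V1 :|: V2 = W, [disjoint V1 & V2], 2 <= #|V1| & 2 <= #|V2|] /\ rank1 V1 V2.
  have [V1 [V2 [UV dV c1 c2 rk]]] := dh_split W4.
  move: (rW); rewrite -UV => /setUP[rV|rV]; first by exists V1, V2.
  exists V2, V1; split; last exact: rank1_sym.
  by rewrite setUC disjoint_sym.
have V12 x : x \in V2 -> x \notin V1 by move=> xV2; rewrite (disjointFl dV).
have [v vV2 [w wV1 evw]] : exists2 v, v \in V2 & exists2 w, w \in V1 & e v w.
  have [|||x [y [xV yW yV exy]]] := cW V1.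
  - by rewrite -UV subsetUl.
  - by apply/set0Pn; exists r.
  - have /card_gt0P[z zV2] : 0 < #|V2| by apply: ltn_trans c2.
    by apply: contraNneq (V12 z zV2) => ->; rewrite -UV in_setU zV2 orbT.
  exists y; first by move: yW; rewrite -UV in_setU (negPf yV).
  by exists x; rewrite // eS.
have V1W : V1 \subset W by rewrite -UV subsetUl.
have W1 : W :\: V1 = V2.
  apply/setP=> x; rewrite -UV !inE; case: (boolP (x \in V1)) => //= xV1.
  by apply/esym/negbTE; apply: contraL xV1; apply: V12.
have vV1 := V12 v vV2.
have UVc : #|W| = #|V1| + #|V2|.
  by rewrite -UV; apply/eqP; rewrite (leq_card_setU V1 V2).2.
have cW1 : conn (v |: V1).
  by apply: (conn_restrict cW V1W _ _ wV1 evw); rewrite W1.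
have rv : r != v by apply: contraNneq vV1 => <-.
have [A1 [B1 [P rA rB vA]]] : exists A1 B1,
    [/\ tripartition (v |: V1) r A1 B1, rank1 A1 (r |: B1), rank1 B1 (r |: A1) & v \in A1].
  have [|||A [B [P rA rB]]] := IH (v |: V1) r _ _ _ cW1.
  - rewrite cardsU1 vV1; rewrite ltnS in Wn; apply: leq_trans Wn.
    by rewrite UVc add1n -addn2 leq_add2l.
  - by rewrite cardsU1 vV1 add1n ltnS.
  - by rewrite in_setU1 rV1 orbT.
  have [_ _ _ _ /setP/(_ v)] := P; rewrite !inE eqxx eq_sym (negPf rv) /=.
  move=> /esym/orP[vA|vB].
    by exists A, B.
  by exists B, A; split=> //; apply: tripartitionC.
(* A vertex of [V2] with a neighbour in [V1] has the same neighbours in [V1] as [v]; this is why [v]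
   can represent [V2]. *)
have {rk}nbr x y y' : x \in V2 -> y \in V1 -> y' \in V1 -> e x y -> e x y' = e v y'.
  move=> xV2 yV1 y'V1 exy; rewrite [RHS]eS [LHS]eS; apply/idP/idP => H.
    by apply: (rk y' w x v) => //; rewrite eS.
  by apply: (rk y' y v x) => //; rewrite eS.
case: P => A0 B0 dAB rAB EW.
have B1V1 x : x \in r |: B1 -> x \in V1.
  case/setU1P=> [->//|xB]; have : x \in v |: V1 by rewrite EW !inE xB !orbT.
  by case/setU1P=> // xv; rewrite xv (disjointFr dAB vA) in xB.
pose A := V2 :|: (A1 :\ v).
(* A vertex of [A] with a neighbour in [r |: B1] has a representative in [A1] with the same
   neighbours there, so rank 1 is inherited from the contracted graph. *)
have img x y : x \in A -> y \in r |: B1 -> e x y ->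
    exists2 z, z \in A1 & forall y', y' \in r |: B1 -> e x y' = e z y'.
  case/setUP=> [xV2|/setD1P[_ xA] _ _]; last by exists x.
  move=> /B1V1 yV1 exy; exists v => // y' /B1V1 y'V1; exact: nbr exy.
have V2A : {subset V2 <= A} by move=> x xV2; rewrite inE xV2.
have rkA : rank1 A (r |: B1).
  move=> x x' y y' xA x'A yB y'B exy ex'y'.
  have [z zA Ez] := img _ _ xA yB exy; have [z' zA' Ez'] := img _ _ x'A y'B ex'y'.
  by rewrite Ez //; apply: (rA z z' y y') => //; rewrite -?Ez -?Ez'.
have rkB : rank1 B1 (r |: A).
  apply: rank1_sym => x x' y y' xA x'A yB y'B exy ex'y'.
  have img' u z : u \in r |: A -> z \in B1 -> e u z ->
      exists2 u', u' \in r |: A1 & forall z', z' \in B1 -> e u z' = e u' z'.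
    move=> /setU1P[->|uA] zB euz; first by exists r; rewrite ?setU11.
    have [|u' u'A H] := img u z uA _ euz; first by rewrite in_setU1 zB orbT.
    by exists u' => [|z' z'B]; rewrite ?H // in_setU1 ?u'A ?z'B orbT.
  have [z zA Ez] := img' _ _ xA yB exy; have [z' zA' Ez'] := img' _ _ x'A y'B ex'y'.
  by rewrite Ez //; apply: (rank1_sym rB _ zA' yB) => //; rewrite -?Ez -?Ez'.
exists A, B1; split=> //; split=> //.
- by apply/set0Pn; exists v; apply: V2A.
- apply/pred0P=> x /=; apply/negbTE/negP => /andP[/setUP[xV2|/setD1P[_ xA]] xB].
    by have := V12 x xV2; rewrite B1V1 // in_setU1 xB orbT.
  by rewrite (disjointFr dAB xA) in xB.
- move: rAB; rewrite !inE !negb_or negb_and => /andP[-> ->]; rewrite orbT !andbT.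
  by apply/negP => /V12; rewrite rV1.
apply/setP=> x; rewrite -UV !inE; case: (boolP (x \in V2)) => [_|xV2]; first by rewrite !orbT.
have xv : x != v by apply: contraNneq xV2 => ->.
by have /setP/(_ x) := EW; rewrite !inE xv (negPf xv) orbF /=.
Qed.

Definition models W r (t : tree T) :=
  [/\ wf t, uniq (leaves t), leaves t =i W :\ r,
      {in W :\ r &, edge t =2 e} & {in W :\ r, acc t =1 e r}].

Hypothesis eI : irreflexive e.

(** By connectedness at least two of the three pairs among [r], [A], [B] are adjacent. The possible
    patterns are the clique and the three stars on three vertices, and each of them is a join. *)
Theorem dh_tree W r : 2 <= #|W| -> r \in W -> conn W -> exists t, models W r t.
Proof.
have [n] := ubnP #|W|; elim: n => // n IH in W r * => Wn W2 rW cW.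
have [W3|W3] := ltnP 2 #|W|; last first.
  have : #|W :\ r| == 1.
    by move: W2 W3; rewrite (cardsD1 r W) rW add1n !ltnS eqn_leq => -> ->.
  case/cards1P=> x dW; exists (Leaf x); rewrite /models dW; split=> //.
  - by move=> y; rewrite !inE.
  - by move=> y z /set1P-> /set1P->; rewrite eI.
  move=> y /set1P->; rewrite acc_leaf eqxx.
  have rx : r != x by have := set11 x; rewrite -dW !inE eq_sym => /andP[].
  have [|||u [v [/set1P-> vW vr erv]]] := cW [set r].
  - by rewrite sub1set.
  - by apply/set0Pn; exists r; rewrite inE.
  - have : x \in W by have := set11 x; rewrite -dW => /setD1P[].
    by apply: contraTneq => <-; rewrite inE eq_sym.
  have : v \in W :\ r by rewrite !inE vW -in_set1 vr.
  by rewrite dW => /set1P <-; rewrite erv.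
have [A [B [[A0 B0 dAB rAB EW] rA rB]]] := dh_tripartition W3 rW cW.
have [rnA rnB] : r \notin A /\ r \notin B by apply/andP; rewrite -negb_or -in_setU.
(* A vertex [y] outside [C] with a neighbour in [C] serves as the root for [C]. By rank 1 the
   accessible set so obtained is the neighbourhood in [C] of every such vertex, whichever was
   chosen. *)
have part (C D : {set T}) : C != set0 -> D != set0 ->
    [disjoint C & D] -> r \notin C -> r \notin D ->
    W = r |: (C :|: D) -> rank1 C (r |: D) ->
  exists t, [/\ wf t, uniq (leaves t), leaves t =i C, {in C &, edge t =2 e} &
    forall y, y \in r |: D -> (exists2 x, x \in C & e y x) -> {in C, acc t =1 e y}].
  move=> C0 D0 dCD rC rD EW' rkC.
  have WC : W :\: C = r |: D.
    apply/setP=> x; rewrite EW' !inE; case: (boolP (x \in C)) => xC /=; last by [].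
    rewrite (disjointFr dCD xC) orbF; apply/esym/negbTE.
    by apply: contraNneq rC => <-.
  have CW : C \subset W by rewrite EW' setUCA subsetUl.
  have [|||x [y [xC yW yC exy]]] := cW C => //.
    by apply: contraNneq rC => ->.
  have yD : y \in r |: D by rewrite -WC inE yC.
  have [t [wt ut lt et at_]] : exists t, models (y |: C) y t.
    apply: IH.
    - rewrite cardsU1 yC; rewrite ltnS in Wn; apply: leq_trans Wn.
      have cCD : #|C :|: D| = #|C| + #|D| by apply/eqP; rewrite (leq_card_setU C D).2.
      rewrite EW' cardsU1 in_setU negb_or rC rD cCD !add1n !ltnS.
      by rewrite -addn1 leq_add2l card_gt0.
    - rewrite cardsU1 yC add1n ltnS card_gt0 //.
    - exact: setU11.
    - by apply: (conn_restrict cW CW _ _ xC); rewrite ?WC // eS.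
  rewrite setU1K // in lt et at_; exists t; split=> //.
  move=> z zD [u uC ezu] v vC; rewrite at_ //; apply/idP/idP => H.
    by rewrite eS; apply: (rkC v u y z) => //; rewrite eS.
  by rewrite eS; apply: (rkC v x z y) => //; rewrite eS.
have [a [wa ua la ea xa]] := part A B A0 B0 dAB rnA rnB EW rA.
have [b [wb ub lb eb xb]] : exists b, [/\ wf b, uniq (leaves b), leaves b =i B,
    {in B &, edge b =2 e} &
    forall y, y \in r |: A -> (exists2 x, x \in B & e y x) -> {in B, acc b =1 e y}].
  by apply: part; rewrite // 1?disjoint_sym // (setUC B).
have glue k (C D : {set T}) (c d : tree T) : k < 3 ->
    [disjoint C & D] -> W :\ r = C :|: D -> wf c -> wf d ->
    uniq (leaves c) -> uniq (leaves d) -> leaves c =i C -> leaves d =i D ->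
    {in C &, edge c =2 e} -> {in D &, edge d =2 e} ->
    {in C, forall x, e r x = acc c x} -> {in D, forall x, e r x = (k != 2) && acc d x} ->
    {in C & D, forall x y, e x y = [&& k != 1, acc c x & acc d y]} ->
  exists t, models W r t.
  move=> k3 dCD EW' wc wd uc ud lc ld ec ed rc rd ecd.
  have [t wt [pt at_ et]] := node_wf k3 wc wd.
  have ut : uniq (leaves (Node k [:: c; d])).
    rewrite leaves_cons leaves1 cat_uniq uc ud andbT /=; apply/hasPn => x.
    by rewrite ld /= lc => xD; rewrite (disjointFl dCD xD).
  exists t; rewrite /models EW'; split=> //; first by rewrite (perm_uniq pt).
  - by move=> x; rewrite (perm_mem pt) leaves_cons leaves1 mem_cat lc ld inE.
  - have lt2 x : x \in D -> x \in leaves (Node k [:: d]) by rewrite leaves1 ld.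
    have lt1 x : x \in C -> x \in leaves c by rewrite lc.
    move=> x y; rewrite et => /setUP[xC|xD] /setUP[yC|yD].
    + by rewrite (edge_head ut) ?lt1 // ec.
    + by rewrite (edge_cross ut) ?lt1 ?lt2 // acc1 ecd.
    + by rewrite edge_sym (edge_cross ut) ?lt1 ?lt2 // acc1 eS ecd.
    + by rewrite (edge_tail ut) ?lt2 // edge1 ed.
  move=> x; rewrite at_ => /setUP[xC|xD].
    by rewrite (acc_head ut) ?lc // rc.
  by rewrite (acc_tail ut) ?leaves1 ?ld // acc1 rd.
have WAB : W :\ r = A :|: B by rewrite EW setU1K.
have WBA : W :\ r = B :|: A by rewrite setUC.
have dBA : [disjoint B & A] by rewrite disjoint_sym.
pose ra := [exists x in A, e r x]; pose rb := [exists x in B, e r x].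
pose ab := [exists x in A, exists y in B, e x y].
have era : {in A, forall x, e r x = ra && acc a x}.
  move=> x xA; have [/exists_inP[z zA erz]|/exists_inP nra] := boolP ra.
    by rewrite (xa r) ?setU11 //; exists z.
  by apply/negP => erx; apply: nra; exists x.
have erb : {in B, forall x, e r x = rb && acc b x}.
  move=> x xB; have [/exists_inP[z zB erz]|/exists_inP nrb] := boolP rb.
    by rewrite (xb r) ?setU11 //; exists z.
  by apply/negP => erx; apply: nrb; exists x.
have eab : {in A & B, forall x y, e x y = [&& ab, acc a x & acc b y]}.
  move=> x y xA yB; have yrB : y \in r |: B by rewrite in_setU1 yB orbT.
  have [/exists_inP[x0 x0A /exists_inP[y0 y0B e0]]|/exists_inP nab] := boolP ab; last first.
    by apply/negP => exy; apply: nab; exists x => //; apply/exists_inP; exists y.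
  have [x0rA y0rB] : x0 \in r |: A /\ y0 \in r |: B by rewrite !in_setU1 x0A y0B !orbT.
  rewrite (xa y0) //; last by exists x0; rewrite // eS.
  rewrite (xb x0) //; last by exists y0.
  rewrite /=; apply/idP/andP => [exy|[exy0 ex0y]]; last by apply: (rA x x0 y0 y); rewrite // eS.
  split; last exact: (rA x0 x y0 y).
  by rewrite eS; apply: (rA x x0 y y0).
have ab_edge x y : e x y -> x \in A -> y \in B -> ab.
  by move=> exy xA yB; apply/exists_inP; exists x => //; apply/exists_inP; exists y.
have conn_ra_ab : ra || ab.
  have [|||x [y [xA yW yA exy]]] := cW A.
  - by rewrite EW setUCA subsetUl.
  - by [].
  - by apply: contraNneq rnA => ->.
  move: yW; rewrite EW !inE (negPf yA) /= => /orP[/eqP yr|yB].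
    by apply/orP; left; apply/exists_inP; exists x; rewrite // eS -yr.
  by rewrite (ab_edge x y) ?orbT.
have conn_rb_ab : rb || ab.
  have [|||x [y [xB yW yB exy]]] := cW B.
  - by rewrite EW setUA subsetUr.
  - by [].
  - by apply: contraNneq rnB => ->.
  move: yW; rewrite EW !inE (negPf yB) orbF /= => /orP[/eqP yr|yA].
    by apply/orP; left; apply/exists_inP; exists x; rewrite // eS -yr.
  by rewrite (ab_edge y x) ?orbT // eS.
have conn_ra_rb : ra || rb.
  have [|||x [y [/set1P-> yW yr exy]]] := cW [set r].
  - by rewrite sub1set.
  - by apply/set0Pn; exists r; rewrite inE.
  - by apply: contraTneq W2 => <-; rewrite cards1.
  move: yW yr; rewrite EW !inE => /predU1P[->|/orP[yA|yB]]; first by rewrite eqxx.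
    by move=> _; apply/orP; left; apply/exists_inP; exists y.
  by move=> _; apply/orP; right; apply/exists_inP; exists y.
(* All three adjacencies give a clique. When [ab], [rb] or [ra] fails, the pattern is a star with
   centre [r], [A] or [B] respectively; the last two are joins of kind 2 with the central part
   first. *)
case: (boolP ra) conn_ra_ab conn_ra_rb era => [_ _ _ era|_ /= hab hrb era].
  case: (boolP rb) conn_rb_ab erb eab => [_ _ erb|_ /= -> erb] eab.
    by case: (ab) eab => eab; [apply: (glue 0 A B a b) | apply: (glue 1 A B a b)].
  by apply: (glue 2 A B a b).
rewrite hrb hab in erb eab.
apply: (glue 2 B A b a) => // x y xB yA.
by rewrite eS eab //= andbC.
Qed.

End SplitToTree.

(** * From trees to splits *)

Section TreeToSplit.
Variable T : countType.
Implicit Types (t : tree T) (V : pred T).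

(* [None] stands for a root attached to the accessible vertices. *)
Definition nbr t x (w : option T) := if w is Some y then edge t x y else acc t x.

Lemma count_le1 V (s : seq T) x y : uniq s -> count V s <= 1 ->
  x \in s -> V x -> y \in s -> V y -> x = y.
Proof.
move=> us; rewrite -size_filter => s1 xs Vx ys Vy.
have xf : x \in filter V s by rewrite mem_filter Vx.
have yf : y \in filter V s by rewrite mem_filter Vy.
by case: (filter V s) s1 xf yf => [|z []] // _; rewrite !inE => /eqP-> /eqP->.
Qed.

Lemma edge_irr t x : uniq (leaves t) -> edge t x x = false.
Proof.
elim/tree_ind_cons: t => [y|//|k c cs IHc IH] u; first by rewrite edge_leaf.
rewrite edge_cons IHc ?(head_uniq u) // IH ?(tail_uniq u) // orbb /=.
apply/negP => /and3P[_ /acc_leaves xc /acc_leaves].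
by rewrite (negPf (head_notin_tail u xc)).
Qed.

(** The cut is taken between [u], [v] and the other vertices of [V] together with the root. The root
    is always included, even if the set to be split omits it, because for a part of a tree it stands
    for vertices lying elsewhere. *)
Definition split_pair t V u v :=
  [/\ u != v, V u && V v, u \in leaves t, v \in leaves t &
    forall x x' w w', x \in [:: u; v] -> x' \in [:: u; v] ->
      (if w is Some y then V y && (y \notin [:: u; v]) else true) ->
      (if w' is Some y then V y && (y \notin [:: u; v]) else true) ->
      nbr t x w -> nbr t x' w' -> nbr t x w'].

(* Seen from a part [d] of [t], a vertex outside looks like the root or is isolated. *)
Lemma split_pair_part t d V u v : {subset leaves d <= leaves t} ->
  (forall w, exists b w', {in leaves d, forall y, nbr t y w = b && nbr d y w'} /\
     (if w' is Some _ then w = w' else True)) ->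
  split_pair d V u v -> split_pair t V u v.
Proof.
move=> sub outside [uv VV ud vd H]; split; rewrite ?sub // => x x' w w' xin x'in Hw Hw'.
have inl z : z \in [:: u; v] -> z \in leaves d by rewrite !inE => /orP[]/eqP->.
have [b [w1 [E1 F1]]] := outside w; have [b' [w1' [E2 F2]]] := outside w'.
rewrite E1 ?inl // !E2 ?inl // => /andP[_ n1] /andP[-> n2] /=.
apply: (H x x' w1 w1') => //; first by case: w1 F1 {E1 n1} => // y Ew; rewrite Ew in Hw.
by case: w1' F2 {E2 n2} => // y Ew; rewrite Ew in Hw'.
Qed.

(** If the head or the tail holds two vertices of [V], the pair is found there. Otherwise each holds
    exactly one, no further leaf belongs to [V], and a cut towards the root alone has rank at most
    1. *)
Lemma tree_split_pair t V : uniq (leaves t) -> 1 < count V (leaves t) ->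
  exists u v, split_pair t V u v.
Proof.
elim/tree_ind_cons: t => [z|//|k c cs IHc IH] ut; first by rewrite /=; case: (V z).
have uc := head_uniq ut; have ud := tail_uniq ut.
rewrite leaves_cons count_cat => s2.
have [c2|c1] := ltnP 1 (count V (leaves c)).
  have [u [v P]] := IHc uc c2; exists u, v; apply: split_pair_part P.
    by move=> x xc; rewrite leaves_cons mem_cat xc.
  move=> [z|]; last by exists true, None; split=> // y yc; apply: (acc_head ut).
  have [zc|zc] := boolP (z \in leaves c).
    by exists true, (Some z); split=> // y yc; apply: (edge_head ut).
  have [zd|zd] := boolP (z \in leaves (Node k cs)).
    exists ((k != 1) && acc (Node k cs) z), None; split=> // y yc.
    by rewrite /= (edge_cross ut) // -andbA [acc c y && _]andbC.
  exists false, None; split=> // y yc; apply/negP => /edge_leavesr.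
  by rewrite leaves_cons mem_cat (negPf zc) (negPf zd).
have [d2|d1] := ltnP 1 (count V (leaves (Node k cs))).
  have [u [v P]] := IH ud d2; exists u, v; apply: split_pair_part P.
    by move=> x xd; rewrite leaves_cons mem_cat xd orbT.
  move=> [z|]; last by exists (k != 2), None; split=> // y yd; apply: (acc_tail ut).
  have [zd|zd] := boolP (z \in leaves (Node k cs)).
    by exists true, (Some z); split=> // y yd; apply: (edge_tail ut).
  have [zc|zc] := boolP (z \in leaves c).
    exists ((k != 1) && acc c z), None; split=> // y yd.
    by rewrite /= edge_sym (edge_cross ut) // -andbA.
  exists false, None; split=> // y yd; apply/negP => /edge_leavesr.
  by rewrite leaves_cons mem_cat (negPf zc) (negPf zd).
have [hc hd] : has V (leaves c) /\ has V (leaves (Node k cs)).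
  rewrite !has_count; move: s2 c1 d1.
  by case: (count V (leaves c)) => [|[|//]]; case: (count V (leaves (Node k cs))) => [|[|//]].
have [u uc' Vu] := hasP hc; have [v vd' Vv] := hasP hd.
exists u, v; split; rewrite ?leaves_cons ?mem_cat ?uc' ?vd' ?orbT ?Vu ?Vv //.
  by apply: contraTneq uc' => ->; rewrite (tail_notin_head ut).
have none w x : (if w is Some y then V y && (y \notin [:: u; v]) else true) ->
    nbr (Node k (c :: cs)) x w -> w = None.
  case: w => // y /andP[Vy]; rewrite !inE negb_or => /andP[yu yv] /edge_leavesr.
  rewrite leaves_cons mem_cat => /orP[yc|yd].
    by rewrite (count_le1 uc c1 yc Vy uc' Vu) eqxx in yu.
  by rewrite (count_le1 ud d1 yd Vy vd' Vv) eqxx in yv.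
by move=> x x' w w' _ _ Hw Hw' n1 n2; rewrite (none w' x' Hw' n2) -(none w x Hw n1).
Qed.

End TreeToSplit.

(** * Rooted graphs represented by trees *)

Section Represent.
Variable n : nat.
Implicit Types (g h : rooted n) (t : tree 'I_n).

(* [adj g] is obtained by attaching the root of [g] to the accessible leaves of [t]. *)
Definition represents g t :=
  [/\ wf t, uniq (g.2 :: leaves t), forall x, x \in g.2 :: leaves t &
      forall x y, adj g x y = edge (Node 0 [:: Leaf g.2; t]) x y].

(** The root and [t] form a clique join, so the lemmas on heads and tails of nodes apply to the
    whole graph. *)
Lemma rooted_uniq r t : uniq (r :: leaves t) = uniq (leaves (Node 0 [:: Leaf r; t])).
Proof. by rewrite leaves_cons leaves1. Qed.

Lemma represents_acc g t x : represents g t -> x \in leaves t -> adj g g.2 x = acc t x.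
Proof.
case=> wt; rewrite rooted_uniq => u _ -> xt.
by rewrite (edge_cross u) ?leaves1 ?inE // acc1 acc_leaf eqxx.
Qed.

Lemma represents_edge g t x y : represents g t -> x \in leaves t -> y \in leaves t ->
  adj g x y = edge t x y.
Proof.
by case=> wt; rewrite rooted_uniq => u _ -> xt yt; rewrite (edge_tail u) ?leaves1 // edge1.
Qed.

Lemma represents_exist r t : wf t -> uniq (r :: leaves t) -> (forall x, x \in r :: leaves t) ->
  exists2 g, g.2 = r & represents g t.
Proof.
move=> wt u a; exists ([set p | edge (Node 0 [:: Leaf r; t]) p.1 p.2], r) => //.
by split=> // x y; rewrite /adj inE.
Qed.

Lemma represents_inj g h t : represents g t -> represents h t -> g.2 = h.2 -> g = h.
Proof.
case: g h => [E r] [F s] [_ _ _ Eg] [_ _ _ Eh] /= rs; subst s; congr pair.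
by apply/setP=> -[x y]; have := Eg x y; have := Eh x y; rewrite /adj /= => -> ->.
Qed.

Lemma represents_unique g t t' : represents g t -> represents g t' -> canon t = canon t'.
Proof.
move=> rt rt'; have [wt /= /andP[rnt ut] at_ _] := rt; have [wt' /= /andP[rnt' ut'] at' _] := rt'.
have tt' : leaves t =i leaves t'.
  move=> x; have := at_ x; have := at' x; rewrite !inE.
  by case: eqP => [->|_ /= -> ->] //; rewrite (negPf rnt) (negPf rnt').
apply: canon_unique => //; split; first exact: uniq_perm.
  move=> x; case: (boolP (x \in leaves t)) => xt.
    by rewrite -(represents_acc rt) // (represents_acc rt') // -tt'.
  by apply/idP/idP => /acc_leaves; rewrite -?tt' (negPf xt).
move=> x y; case: (boolP (x \in leaves t)) => xt; last first.
  by apply/idP/idP => /edge_leavesl; rewrite -?tt' (negPf xt).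
case: (boolP (y \in leaves t)) => yt; last first.
  by apply/idP/idP => /edge_leavesr; rewrite -?tt' (negPf yt).
by rewrite -(represents_edge rt) // (represents_edge rt') // -tt'.
Qed.

Lemma represents_eqv g t t' : represents g t -> wf t' -> eqv t t' -> represents g t'.
Proof.
case=> wt u a E wt' ev; have [p _ _] := ev.
have {}p : perm_eq (g.2 :: leaves t) (g.2 :: leaves t') by rewrite perm_cons.
split=> // [|x|x y]; first by rewrite -(perm_uniq p).
  by rewrite -(perm_mem p).
rewrite E; case: (@eqv_cons _ 0 (Leaf g.2) (Leaf g.2) [:: t] [:: t']) => //.
by apply: eqv_cons ev _; apply: eqv_refl.
Qed.

Lemma represents_dh g t : represents g t -> rooted_dh g.
Proof.
move=> rt; have [wt u a E] := rt; have ut := u; rewrite rooted_uniq in ut.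
have [rnt ult] := andP (u : (g.2 \notin leaves t) && uniq (leaves t)).
have adjS x y : adj g x y = adj g y x by rewrite !E edge_sym.
apply/and3P; split.
- apply/andP; split; last by apply/forallP=> x; apply/forallP=> y; apply/eqP.
  by apply/forallP=> x; rewrite E edge_irr.
- have root x : connect (adj g) g.2 x.
    apply/negPn/negP => nx.
    have xt : x \in leaves t.
      by have := a x; rewrite inE => /predU1P[xr|//]; rewrite xr connect0 in nx.
    have [[y ay ny]|[y [z [e ny]]]] :=
      @tree_conn _ t (predC (connect (adj g) g.2)) (wf_nonempty wt) (ex_intro2 _ _ x xt nx).
      by case/negP: ny; apply: connect1; rewrite (represents_acc rt) // acc_leaves.
    rewrite /= negbK => cz; case/negP: ny; apply: connect_trans cz (connect1 _).
    by rewrite (represents_edge rt) ?(edge_leavesl e) ?(edge_leavesr e) // edge_sym.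
  apply/forallP=> x; apply/forallP=> y.
  have cS : connect_sym (adj g) by apply: sym_connect_sym => ? ?; apply: adjS.
  by apply: connect_trans (root y); rewrite cS.
apply/forallP=> V; apply/implyP => V4.
(* At most one of the four vertices is the root, so enough of them are leaves to find a pair. *)
have V2 : 1 < count (mem V) (leaves t).
  have : count (mem V) (g.2 :: leaves t) = #|V|.
    rewrite -size_filter cardE; apply: perm_size; apply: uniq_perm.
    - exact: filter_uniq.
    - exact: enum_uniq.
    - by move=> x; rewrite mem_filter a andbT mem_enum.
  move=> /= cV; rewrite -ltnS -[X in _ < X]add1n.
  by apply: leq_trans (leq_add (leq_b1 (mem V g.2)) (leqnn _)); rewrite cV ltnW.
have [u1 [v1 [uv /andP[uV vV] u1t v1t H]]] := tree_split_pair ult V2.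
pose V1 := [set u1; v1].
have V1V : V1 \subset V by apply/subsetP=> x /set2P[]->.
have cV1 : #|V1| = 2 by rewrite cards2 uv.
apply/existsP; exists V1; apply/existsP; exists (V :\: V1); apply/and5P; split.
- apply/eqP/setP=> z; rewrite in_setU in_setD.
  by case: (boolP (z \in V1)) => //= /(subsetP V1V) ->.
- by apply/eqP/setP=> z; rewrite in_setI in_setD in_set0; case: (z \in V1).
- by rewrite cV1.
- by rewrite cardsD (setIidPr V1V) cV1 leq_subRL //; apply: leq_trans V4.
have V1E z : (z \in V1) = (z \in [:: u1; v1]) by rewrite !inE.
pose opt z := if z == g.2 then None else Some z.
have nbrE x z : x \in V1 -> adj g x z = nbr t x (opt z).
  move=> xV1; have xt : x \in leaves t by case/set2P: xV1 => ->.
  rewrite /opt; case: eqP => [->|/eqP zr]; first by rewrite adjS (represents_acc rt).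
  rewrite /= (represents_edge rt) //.
  by have := a z; rewrite inE (negPf zr).
have optV z : z \in V :\: V1 -> if opt z is Some y then (y \in V) && (y \notin [:: u1; v1]) else true.
  by rewrite /opt in_setD andbC V1E; case: (z == g.2).
apply/forall_inP=> x xV1; apply/forall_inP=> y yV2; apply/implyP=> /andP[].
case/exists_inP=> y' y'V2; rewrite nbrE // => e1.
case/exists_inP=> x' x'V1; rewrite !nbrE // => e2.
by apply: (H x x' (opt y') (opt y)); rewrite ?optV // -V1E.
Qed.

End Represent.

Section RootedGraphs.
Variable n : nat.
Implicit Types (g h : rooted n) (t : tree 'I_n).

Lemma connected_conn (e : rel 'I_n) : symmetric e -> connected_graph e -> conn e [set: 'I_n].
Proof.
move=> eS /forallP cg S _ /set0Pn[x xS] ST.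
have [y yS] : exists y, y \notin S.
  by apply/existsP; apply: contraNT ST => /existsPn H; apply/eqP/setP=> y; rewrite inE; apply/negPn/H.
have [/exists_inP[u uS /exists_inP[v vS euv]]|/exists_inP nex] :=
    boolP [exists u in S, exists v in ~: S, e u v].
  by exists u, v; split=> //; rewrite ?inE // -in_setC.
have cS u v : e u v -> (u \in S) = (v \in S).
  move=> euv; apply/idP/idP => [uS|vS]; apply/negPn/negP => nS; apply: nex.
    by exists u => //; apply/exists_inP; exists v; rewrite ?inE.
  by exists v => //; apply/exists_inP; exists u; rewrite ?inE // eS.
have := closed_connect cS (forallP (cg x) y).
by rewrite xS (negPf yS).
Qed.

Lemma dh_represents g : 1 < n -> rooted_dh g -> exists t, represents g t.
Proof.
move=> n1 /and3P[/andP[/forallP irr /forallP symg] cg dg].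
have eS : symmetric (adj g) by move=> x y; apply/eqP/(forallP (symg x)).
have eI : irreflexive (adj g) by move=> x; apply/negbTE/irr.
have [|t [wt ut lt et at_]] := @dh_tree _ _ eS dg eI setT g.2 _ (in_setT _) (connected_conn eS cg).
  by rewrite cardsT card_ord.
have lt' x : (x \in leaves t) = (x != g.2) by rewrite lt !inE andbT.
have u : uniq (g.2 :: leaves t) by rewrite /= ut lt' eqxx.
exists t; split=> // [x|x y]; first by rewrite inE lt'; case: eqP.
have u' := u; rewrite rooted_uniq in u'.
have [xr|xr] := eqVneq x g.2; have [yr|yr] := eqVneq y g.2.
- by rewrite xr yr edge_irr // eI.
- rewrite xr (edge_cross u') ?leaves1 ?lt' ?inE // acc1 acc_leaf eqxx /=.
  by rewrite at_ // !inE yr.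
- rewrite yr eS edge_sym (edge_cross u') ?leaves1 ?lt' ?inE // acc1 acc_leaf eqxx /=.
  by rewrite at_ // !inE xr.
by rewrite (edge_tail u') ?leaves1 ?lt' // edge1 et // !inE ?xr ?yr.
Qed.

Lemma represents_adj g h t t' (p : 'I_n -> 'I_n) : injective p -> p g.2 = h.2 ->
  tmap p t = t' -> represents g t -> represents h t' ->
  forall x y, adj g x y = adj h (p x) (p y).
Proof.
move=> pI pr pt [_ _ _ Eg] [_ _ _ Eh] x y.
by rewrite Eg Eh -pr -pt -(edge_tmap (Node 0 [:: Leaf g.2; t]) _ _ pI).
Qed.

Lemma represents_tmap g h t (p : {perm 'I_n}) : p g.2 = h.2 ->
  (forall x y, adj g x y = adj h (p x) (p y)) -> represents g t -> represents h (tmap p t).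
Proof.
move=> pr pa [wt u a Eg].
have e : h.2 :: leaves (tmap p t) = [seq p x | x <- g.2 :: leaves t].
  by rewrite leaves_tmap /= pr.
split; rewrite ?wf_tmap ?e ?(map_inj_uniq perm_inj) //.
  by move=> x; rewrite -(permKV p x) map_f.
move=> x y; rewrite -(permKV p x) -(permKV p y) -pa Eg -pr.
by rewrite -(edge_tmap _ _ _ (@perm_inj _ p)).
Qed.

Lemma canon_unlabel (T T' : countType) (p : T -> T') (t : tree T) (t' : tree T') :
  canon (tmap p t) = canon t' -> canon (unlabel t) = canon (unlabel t').
Proof.
move=> e; rewrite -(canon_tmap (fun=> tt) t') -e canon_tmap tmap_comp.
by congr canon.
Qed.

Lemma eqv_canon_eq (T : countType) (t t' : tree T) : canon t = canon t' -> eqv t t'.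
Proof. by move=> e; apply: eqv_trans (eqv_sym (eqv_canon t)) _; rewrite e; apply: eqv_canon. Qed.

Lemma rooted_isoP g h t t' : represents g t -> represents h t' ->
  reflect (canon (unlabel t) = canon (unlabel t')) (rooted_iso g h).
Proof.
move=> rg rh; apply: (iffP existsP) => [[p /andP[/eqP pr /forallP pa]]|e].
  apply: (@canon_unlabel _ _ p); apply: represents_unique rh.
  by apply: represents_tmap rg => // x y; apply/eqP/(forallP (pa x)).
have [t1 c1 s1] := tmap_reorder (fun=> tt) t.
have [t2 c2 s2] := tmap_reorder (fun=> tt) t'.
have r1 : represents g t1.
  apply: (represents_eqv rg _ (eqv_sym (eqv_canon_eq c1))).
  by rewrite -wf_canon c1 wf_canon; case: rg.
have r2 : represents h t2.
  apply: (represents_eqv rh _ (eqv_sym (eqv_canon_eq c2))).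
  by rewrite -wf_canon c2 wf_canon; case: rh.
have sh : unlabel t1 = unlabel t2 by rewrite s1 e s2.
have sz : size (leaves t1) = size (leaves t2).
  by rewrite -size_leaves_unlabel sh size_leaves_unlabel.
have [_ u1 a1 _] := r1; have [_ u2 a2 _] := r2.
(* Root to root, then leaves from left to right: [t1] and [t2] have the same shape, so this
   positional bijection carries one to the other. By [ix] the default [h.2] is never reached. *)
pose p x := nth h.2 (h.2 :: leaves t2) (index x (g.2 :: leaves t1)).
have ix x : index x (g.2 :: leaves t1) < size (h.2 :: leaves t2).
  have -> : size (h.2 :: leaves t2) = size (g.2 :: leaves t1) by rewrite /= sz.
  by rewrite index_mem.
have pI : injective p.
  move=> x y /eqP; rewrite nth_uniq ?ix // => /eqP /(congr1 (nth x (g.2 :: leaves t1))).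
  by rewrite !nth_index.
have pr : p g.2 = h.2 by rewrite /p /= eqxx.
have pm : [seq p x | x <- leaves t1] = leaves t2.
  have : [seq p x | x <- g.2 :: leaves t1] = h.2 :: leaves t2.
    apply: (@eq_from_nth _ h.2) => [|i]; first by rewrite size_map /= sz.
    rewrite size_map => ilt.
    by rewrite (nth_map g.2) // /p index_uniq.
  by case.
exists (perm pI); rewrite permE pr eqxx /=; apply/forallP=> x; apply/forallP=> y.
by rewrite !permE; apply/eqP; apply: (represents_adj pI pr (tmap_unlabel sh pm) r1 r2).
Qed.

End RootedGraphs.

(** * Equinumerosity and the uniqueness of the solution *)

(** With choice, a correspondence is enough: sets and multisets can be related to trees through any
    listing of their elements, with no function to write down. *)
Lemma rel_bijective (P Q : Type) (R : P -> Q -> Prop) :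
  (forall p, exists q, R p q) -> (forall q, exists p, R p q) ->
  (forall p q q', R p q -> R p q' -> q = q') ->
  (forall p p' q, R p q -> R p' q -> p = p') -> exists2 f : P -> Q, bijective f & forall p, R p (f p).
Proof.
move=> totP totQ funR injR.
pose f p := proj1_sig (constructive_indefinite_description _ (totP p)).
pose g q := proj1_sig (constructive_indefinite_description _ (totQ q)).
have fR p : R p (f p) by rewrite /f; case: constructive_indefinite_description.
have gR q : R (g q) q by rewrite /g; case: constructive_indefinite_description.
exists f => //; exists g => [p|q]; [exact: injR (gR _) (fR _) | exact: funR (fR _) (gR _)].
Qed.

Lemma equi_rel (A B : sized) n (R : A -> B -> Prop) :
  (forall a, size_of a = n -> exists2 b, size_of b = n & R a b) ->
  (forall b, size_of b = n -> exists2 a, size_of a = n & R a b) ->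
  (forall a b b', size_of a = n -> size_of b = n -> size_of b' = n ->
     R a b -> R a b' -> b = b') ->
  (forall a a' b, size_of a = n -> size_of a' = n -> size_of b = n ->
     R a b -> R a' b -> a = a') ->
  equinumerous_at A B n.
Proof.
move=> totA totB funR injR.
have [||||f fb _] := @rel_bijective {a : A | size_of a == n} {b : B | size_of b == n}
  (fun a b => R (val a) (val b)); last by exists f.
- move=> [a an]; have [b /eqP bn ab] := totA a (eqP an).
  by exists (exist _ b bn).
- move=> [b bn]; have [a /eqP an ab] := totB b (eqP bn).
  by exists (exist _ a an).
- by move=> [a /eqP an] [b bn] [b' bn'] /= ab ab'; apply: val_inj; apply: funR ab ab' => //; apply/eqP.
- by move=> [a an] [a' an'] [b /eqP bn] /= ab ab'; apply: val_inj; apply: injR ab ab' => //; apply/eqP.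
Qed.

Lemma equi_map (A B : sized) n (f : A -> B) :
  (forall a, size_of (f a) = size_of a) -> injective f ->
  (forall b, size_of b = n -> exists a, f a = b) -> equinumerous_at A B n.
Proof.
move=> sf If sur; apply: (@equi_rel A B n (fun a b => f a = b)).
- by move=> a an; exists (f a); rewrite ?sf.
- by move=> b bn; have [a fa] := sur b bn; exists a; rewrite // -sf fa.
- by move=> a b b' _ _ _ <- <-.
- by move=> a a' b _ _ _ <- /If.
Qed.

Lemma equi_refl (A : sized) n : equinumerous_at A A n.
Proof. by exists id; exists id. Qed.

Lemma equi_sym (A B : sized) n : equinumerous_at A B n -> equinumerous_at B A n.
Proof. by case=> f [g fK gK]; exists g; exists f. Qed.

Lemma equi_trans (B A C : sized) n :
  equinumerous_at A B n -> equinumerous_at B C n -> equinumerous_at A C n.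
Proof. by case=> f bf [g bg]; exists (g \o f); apply: bij_comp. Qed.

Lemma equi_empty (A B : sized) n : (forall a : A, size_of a != n) ->
  (forall b : B, size_of b != n) -> equinumerous_at A B n.
Proof.
move=> hA hB; apply: (@equi_rel A B n (fun _ _ => False)) => //.
  by move=> a /eqP; rewrite (negPf (hA a)).
by move=> b /eqP; rewrite (negPf (hB b)).
Qed.

Lemma equi_csum (A B A' B' : sized) n : equinumerous_at A A' n ->
  equinumerous_at B B' n -> equinumerous_at (csum A B) (csum A' B') n.
Proof.
move=> [f [f' fK f'K]] [g [g' gK g'K]].
apply: (@equi_rel (csum A B) (csum A' B') n (fun u v => match u, v with
  | inl a, inl a' => exists h h', f (exist _ a h) = exist _ a' h'
  | inr b, inr b' => exists h h', g (exist _ b h) = exist _ b' h'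
  | _, _ => False end)).
- move=> [a|b] /= /eqP h.
    by case e: (f (exist _ a h)) => [a' h']; exists (inl a'); [apply/eqP | exists h, h'].
  by case e: (g (exist _ b h)) => [b' h']; exists (inr b'); [apply/eqP | exists h, h'].
- move=> [a|b] /= /eqP h.
    case e: (f' (exist _ a h)) => [a' h']; exists (inl a'); first exact/eqP.
    by exists h', h; rewrite -e f'K.
  case e: (g' (exist _ b h)) => [b' h']; exists (inr b'); first exact/eqP.
  by exists h', h; rewrite -e g'K.
- move=> [a|b] [a'|b'] [a''|b''] //= _ _ _ [h [h' e]] [k [k' e']].
    by move: e'; rewrite (eq_irrelevance k h) e => -[->].
  by move: e'; rewrite (eq_irrelevance k h) e => -[->].
- move=> [a|b] [a'|b'] [a''|b''] //= _ _ _ [h [h' e]] [k [k' e']].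
    by move: e'; rewrite (eq_irrelevance k' h') -e => /(can_inj fK) [->].
  by move: e'; rewrite (eq_irrelevance k' h') -e => /(can_inj gK) [->].
Qed.

Definition truncated n (A : sized) : sized := @Sized {a : A | size_of a < n} (fun a => size_of (val a)).

(** Bijections are given size by size only. Choosing one for each [m < n] and gluing them yields a
    single map, through which components can be replaced. *)
Lemma equi_truncated (A B : sized) n : (forall m, m < n -> equinumerous_at A B m) ->
  exists f : truncated n A -> truncated n B,
    bijective f /\ forall a, size_of (f a) = size_of a.
Proof.
move=> E.
pose F m (h : m < n) := proj1_sig (constructive_indefinite_description _ (E m h)).
have FB m h : bijective (F m h) by rewrite /F; case: constructive_indefinite_description.
pose R (a : truncated n A) (b : truncated n B) :=
  exists m h pa pb, F m h (exist _ (val a) pa) = exist _ (val b) pb.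
have Rs a b : R a b -> size_of (val b) = size_of (val a).
  by case=> m [h [/eqP-> [/eqP-> _]]].
have [||||f fb fR] := @rel_bijective (truncated n A) (truncated n B) R.
- move=> [a an]; case e: (F _ an (exist _ a (eqxx _))) => [b hb].
  have bn : size_of b < n by rewrite (eqP hb).
  by exists (exist _ b bn), (size_of a), an, (eqxx _), hb.
- move=> [b bn]; have [g gK Kg] := FB _ bn.
  case e: (g (exist _ b (eqxx _))) => [a ha].
  have an : size_of a < n by rewrite (eqP ha).
  by exists (exist _ a an), (size_of b), bn, ha, (eqxx _); rewrite -e Kg.
- move=> a b b' [m [h [pa [pb e]]]] [m' [h' [pa' [pb' e']]]]; apply: val_inj.
  have mm' : m = m' by rewrite -(eqP pa) -(eqP pa').
  subst m'; move: e'; rewrite (bool_irrelevance h' h) (eq_irrelevance pa' pa) e.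
  by case.
- move=> a a' b [m [h [pa [pb e]]]] [m' [h' [pa' [pb' e']]]]; apply: val_inj.
  have mm' : m = m' by rewrite -(eqP pb) -(eqP pb').
  subst m'; move: e'; rewrite (bool_irrelevance h' h) (eq_irrelevance pb' pb) -e.
  by move/(bij_inj (FB m h)); case.
by exists f; split=> // a; apply: Rs.
Qed.

(* The value of [F] at size n depends only on the sizes smaller than n. *)
Definition contractive (F : sized -> sized) := forall n (A B : sized) (f : A -> B),
  no_size0 B -> injective f -> (forall a, size_of (f a) = size_of a) ->
  (forall b, size_of b < n -> exists a, f a = b) -> equinumerous_at (F A) (F B) n.

(** Truncation below [n] does not change the value of [F] at size [n], and the truncations of [A]
    and [B] are in size-preserving bijection. *)
Lemma contractive_equi F A B n : contractive F -> no_size0 A -> no_size0 B ->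
  (forall m, m < n -> equinumerous_at A B m) -> equinumerous_at (F A) (F B) n.
Proof.
move=> cF A0 B0 /equi_truncated[f [fb fs]].
have trunc (C : sized) : no_size0 C -> equinumerous_at (F (truncated n C)) (F C) n.
  move=> C0; apply: (cF n (truncated n C) C val) => //; first exact: val_inj.
  by move=> c cn; exists (exist _ c cn).
apply: equi_trans (equi_sym (trunc A A0)) _.
apply: equi_trans (trunc B B0).
apply: (cF n _ _ f) => //; first by move=> b; apply: B0.
  exact: bij_inj.
by case: fb => g fK gK b _; exists (g b).
Qed.

Lemma contractive_bij F (A B : sized) (f : A -> B) n : contractive F -> no_size0 B ->
  bijective f -> (forall a, size_of (f a) = size_of a) -> equinumerous_at (F A) (F B) n.
Proof.
move=> cF B0 fb fs; apply: (cF n A B f) => //; first exact: bij_inj.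
by case: fb => g fK gK b _; exists (g b).
Qed.

(** This is the effect of the bound 2 in [Set] and [Seq]: any component leaves room for another one
    of positive size, so the recursion on size is well founded. *)
Lemma ltn_sum_mem (I : eqType) (F : I -> nat) (s : seq I) x :
  1 < size s -> (forall y, 0 < F y) -> x \in s -> F x < \sum_(y <- s) F y.
Proof.
move=> s2 F0 xs; rewrite (perm_big _ (perm_to_rem xs)) big_cons /= -addn1 leq_add2l.
have : 0 < size (rem x s) by rewrite size_rem //; case: (size s) s2 => [|[]].
by case: (rem x s) => // y r _; rewrite big_cons (leq_trans (F0 y)) ?leq_addr.
Qed.

Lemma map_surj (I J : eqType) (f : I -> J) (s : seq J) :
  (forall y, y \in s -> exists x, f x = y) -> exists r, [seq f x | x <- r] = s.
Proof.
elim: s => [|y s IH] H; first by exists [::].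
have [x fx] := H y (mem_head _ _).
have [|r fr] := IH; first by move=> z zs; apply: H; rewrite inE zs orbT.
by exists (x :: r); rewrite /= fx fr.
Qed.

Definition rmap (A B : choiceType) (f : A -> B) (p : relabeled A) : relabeled B := (p.1, f p.2).

Lemma rmap_inj (A B : choiceType) (f : A -> B) : injective f -> injective (rmap f).
Proof. by move=> fI [L a] [M b] [-> /fI->]. Qed.

Lemma well_labeled_map (A B : sized) (f : A -> B) s :
  (forall a, size_of (f a) = size_of a) ->
  well_labeled (map (rmap f) s) = well_labeled s.
Proof.
move=> fs; rewrite /well_labeled all_map -map_comp big_map; congr (_ && _).
  by apply: eq_all => p; rewrite /= /relabeled_ok /= fs.
by rewrite (eq_bigr (fun p : relabeled A => size_of p.2)) // => p _; rewrite fs.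
Qed.

Lemma well_labeled_perm (A : sized) (s r : seq (relabeled A)) :
  perm_eq s r -> well_labeled s = well_labeled r.
Proof.
move=> p; rewrite /well_labeled (perm_all _ p) (perm_big _ p) /label_split; congr (_ && _).
have /permPl-> // : perm_eq (flatten [seq enum_fset L | L <- [seq p.1 | p <- s]])
                          (flatten [seq enum_fset L | L <- [seq p.1 | p <- r]]).
apply: perm_flatten.
apply: (@perm_map {fset nat}%fset (seq nat) (fun L => enum_fset L)).
exact: (@perm_map (relabeled A) {fset nat}%fset fst).
Qed.

Lemma mset_perm_inj (K : choiceType) (m m' : {mset K}%mset) :
  perm_eq (enum_mset m) (enum_mset m') -> m = m'.
Proof. by move/eq_seq_msetP; rewrite !seq_mset_id. Qed.

Lemma fset_perm_inj (K : choiceType) (S S' : {fset K}%fset) :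
  perm_eq (enum_fset S) (enum_fset S') -> S = S'.
Proof. by move=> p; apply/fsetP/perm_mem. Qed.

Lemma fset_of_uniq (K : choiceType) (s : seq K) : uniq s ->
  exists S : {fset K}%fset, perm_eq (enum_fset S) s.
Proof.
move=> us; exists (seq_fset tt s).
by apply: perm_trans (seq_fset_perm _ _) _; rewrite undup_id.
Qed.

Lemma uset_of (A : sized) (s : seq A) k : k <= size s ->
  exists m : uset k A, perm_eq (enum_mset (val m)) s.
Proof.
move=> ks; have p := perm_eq_seq_mset s.
have km : k <= size (enum_mset (seq_mset s)) by rewrite (perm_size p).
by exists (exist _ (seq_mset s) km).
Qed.

(** Without objects of size 0 the label sets are nonempty, and being disjoint they are distinct. A
    labeled set is therefore a well-labeled sequence up to order. *)
Lemma well_labeled_uniq (A : sized) (s : seq (relabeled A)) :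
  no_size0 A -> well_labeled s -> uniq s.
Proof.
move=> A0 /andP[/allP ok sp].
have : uniq (flatten [seq enum_fset L | L <- [seq p.1 | p <- s]]).
  by rewrite (perm_uniq sp) iota_uniq.
elim: s ok {sp} => //= p s IH ok; rewrite cat_uniq => /and3P[_ /hasPn H us].
rewrite IH //; last by move=> q qs; apply: ok; rewrite inE qs orbT.
rewrite andbT; apply/negP => ps.
have : 0 < #|` p.1|%fset by rewrite (eqP (ok p (mem_head _ _))).
rewrite /= -has_predT => /hasP[x xp _].
have := H x; rewrite /= xp => /(_ _)/negP; apply=> //.
by apply/flattenP; exists (enum_fset p.1) => //; do 2!apply: map_f.
Qed.

Lemma lset_of (A : sized) (s : seq (relabeled A)) k : no_size0 A -> k <= size s ->
  well_labeled s -> exists S : lset k A, perm_eq (enum_fset (val S)) s.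
Proof.
move=> A0 ks ws; have [S p] := fset_of_uniq (well_labeled_uniq A0 ws).
have kS : (k <= #|` S|%fset) && well_labeled (enum_fset S).
  by rewrite (well_labeled_perm p) ws (perm_size p) ks.
by exists (exist _ S kS).
Qed.

Lemma contractive_useq : contractive (useq 2).
Proof.
move=> n A B f B0 fI fs sur.
have sm (s : seq A) : \sum_(b <- map f s) size_of b = \sum_(a <- s) size_of a.
  by rewrite big_map; apply: eq_bigr => a _; rewrite fs.
apply: (@equi_rel (useq 2 A) (useq 2 B) n (fun s r => map f (val s) = val r)) => /=.
- move=> [s s2] /= sn; have s2' : 2 <= size (map f s) by rewrite size_map.
  by exists (exist _ (map f s) s2'); rewrite //= sm.
- move=> [r r2] /= rn; have [|s fsr] := @map_surj _ _ f r.
    by move=> b br; apply: sur; rewrite -rn; apply: (ltn_sum_mem r2).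
  have s2 : 2 <= size s by rewrite -(size_map f) fsr.
  by exists (exist _ s s2); rewrite //= -sm fsr.
- by move=> s r r' _ _ _ e e'; apply: val_inj; exact: etrans (esym e) e'.
- by move=> s s' r _ _ _ <- /(inj_map fI) e; apply: val_inj.
Qed.

Lemma contractive_uset : contractive (uset 2).
Proof.
move=> n A B f B0 fI fs sur.
have sm (s : seq A) : \sum_(b <- map f s) size_of b = \sum_(a <- s) size_of a.
  by rewrite big_map; apply: eq_bigr => a _; rewrite fs.
apply: (@equi_rel (uset 2 A) (uset 2 B) n
  (fun s r => perm_eq (map f (enum_mset (val s))) (enum_mset (val r)))) => /=.
- move=> [s s2] /= sn; have s2' : 2 <= size (map f (enum_mset s)) by rewrite size_map.
  have [r p] := uset_of s2'; exists r; last by rewrite perm_sym.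
  by rewrite (perm_big _ p) sm.
- move=> [r r2] /= rn; have [|s fsr] := @map_surj _ _ f (enum_mset r).
    by move=> b br; apply: sur; rewrite -rn; apply: (ltn_sum_mem r2).
  have s2 : 2 <= size s by rewrite -(size_map f) fsr.
  have [m p] := uset_of s2; exists m.
    by rewrite (perm_big _ p) -sm fsr.
  by rewrite -fsr; apply: perm_map.
- move=> s r r' _ _ _ e e'; apply/val_inj/mset_perm_inj.
  by apply: perm_trans e'; rewrite perm_sym.
- move=> s s' r _ _ _ e e'; apply/val_inj/mset_perm_inj/(perm_map_inj fI).
  by apply: (perm_trans e); rewrite perm_sym.
Qed.

Section LabeledContractive.
Variables (A B : sized) (f : A -> B).
Hypothesis fs : forall a, size_of (f a) = size_of a.

Lemma sum_rmap (s : seq (relabeled A)) :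
  \sum_(b <- map (rmap f) s) size_of b.2 = \sum_(a <- s) size_of a.2.
Proof. by rewrite big_map; apply: eq_bigr => a _; rewrite fs. Qed.

Lemma rmap_surj n (s : seq (relabeled B)) : no_size0 B ->
  (forall b, size_of b < n -> exists a, f a = b) ->
  1 < size s -> \sum_(b <- s) size_of b.2 = n -> exists r, map (rmap f) r = s.
Proof.
move=> B0 sur s2 sn; apply: map_surj => -[L b] Lb.
have [|a fa] := sur b; last by exists (L, a); rewrite /rmap fa.
by rewrite -sn; apply: (@ltn_sum_mem _ (fun p : relabeled B => size_of p.2) s (L, b)).
Qed.
End LabeledContractive.

Lemma contractive_lseq : contractive (lseq 2).
Proof.
move=> n A B f B0 fI fs sur.
apply: (@equi_rel (lseq 2 A) (lseq 2 B) n (fun s r => map (rmap f) (val s) = val r)) => /=.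
- move=> [s s2] /= sn; have s2' : (2 <= size (map (rmap f) s)) && well_labeled (map (rmap f) s).
    by rewrite size_map well_labeled_map.
  by exists (exist _ (map (rmap f) s) s2'); rewrite //= sum_rmap.
- move=> [r r2] /= rn; have [r21 r22] := andP r2.
  have [s fsr] := rmap_surj B0 sur r21 rn.
  have s2 : (2 <= size s) && well_labeled s.
    by rewrite -(well_labeled_map s fs) -(size_map (rmap f)) fsr.
  by exists (exist _ s s2); rewrite //= -(sum_rmap fs) fsr.
- by move=> s r r' _ _ _ e e'; apply: val_inj; exact: etrans (esym e) e'.
- by move=> s s' r _ _ _ <- /(inj_map (rmap_inj fI)) e; apply: val_inj.
Qed.

Lemma contractive_lset : contractive (lset 2).
Proof.
move=> n A B f B0 fI fs sur.
have A0 : no_size0 A by move=> a; rewrite -fs; apply: B0.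
apply: (@equi_rel (lset 2 A) (lset 2 B) n
  (fun s r => perm_eq (map (rmap f) (enum_fset (val s))) (enum_fset (val r)))) => /=.
- move=> [s s2] /= sn; have [s21 s22] := andP s2.
  have [||r p] := @lset_of B (map (rmap f) (enum_fset s)) 2 B0.
  + by rewrite size_map.
  + by rewrite well_labeled_map.
  by exists r; rewrite 1?perm_sym // (perm_big _ p) sum_rmap.
- move=> [r r2] /= rn; have [r21 r22] := andP r2.
  have [s fsr] := rmap_surj B0 sur r21 rn.
  have [||m p] := @lset_of A s 2 A0.
  + by rewrite -(size_map (rmap f)) fsr.
  + by rewrite -(well_labeled_map s fs) fsr.
  by exists m; rewrite -?fsr ?perm_map // (perm_big _ p) -(sum_rmap fs) fsr.
- move=> s r r' _ _ _ e e'; apply/val_inj/fset_perm_inj.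
  by apply: perm_trans e'; rewrite perm_sym.
- move=> s s' r _ _ _ e e'; apply/val_inj/fset_perm_inj/(perm_map_inj (rmap_inj fI)).
  by apply: (perm_trans e); rewrite perm_sym.
Qed.

Lemma contractive_uprod : contractive (uprod catom).
Proof.
move=> n A B f B0 fI fs sur.
apply: (@equi_rel (uprod catom A) (uprod catom B) n (fun p q => f p.2 = q.2)) => /=.
- by move=> [u a] /= pn; exists (u, f a); rewrite //= fs.
- move=> [u b] /= qn; have [|a fa] := sur b; first by rewrite -qn.
  by exists (u, a); rewrite //= -fs fa.
- by move=> [[] a] [[] b] [[] b'] _ _ _ /= -> ->.
- by move=> [[] a] [[] a'] [[] b] _ _ _ /= <- /fI->.
Qed.

Lemma contractive_lprod : contractive (lprod catom).
Proof.
move=> n A B f B0 fI fs sur.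
apply: (@equi_rel (lprod catom A) (lprod catom B) n
  (fun p q => (val p).1 = (val q).1 /\ rmap f (val p).2 = (val q).2)) => /=.
- move=> [[p1 [L a]] /= pP] /= pn.
  have qP : [&& @relabeled_ok catom p1, @relabeled_ok B (L, f a) &
      label_split [:: p1.1; L] (1 + size_of (f a))].
    by move: pP; rewrite /relabeled_ok /= fs.
  by exists (exist _ (p1, (L, f a)) qP); rewrite //= fs.
- move=> [[q1 [L b]] /= qP] /= qn; have [|a fa] := sur b; first by rewrite -qn.
  have pP : [&& @relabeled_ok catom q1, @relabeled_ok A (L, a) &
      label_split [:: q1.1; L] (1 + size_of a)].
    by move: qP; rewrite /relabeled_ok /= -fa fs.
  by exists (exist _ (q1, (L, a)) pP); rewrite /= -?fs /rmap /= ?fa.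
- move=> p q q' _ _ _ [e1 e2] [e1' e2']; apply: val_inj.
  by rewrite [val q]surjective_pairing [val q']surjective_pairing -e1 -e2 -e1' -e2'.
- move=> p p' q _ _ _ [e1 <-] [e1' /(rmap_inj fI) e2']; apply: val_inj.
  by rewrite [val p]surjective_pairing [val p']surjective_pairing e1 e1' e2'.
Qed.

Lemma contractive_set_ge s : contractive (set_ge s 2).
Proof. by case: s; [apply: contractive_lset | apply: contractive_uset]. Qed.

Lemma contractive_seq_ge s : contractive (seq_ge s 2).
Proof. by case: s; [apply: contractive_lseq | apply: contractive_useq]. Qed.

Lemma contractive_cprod s : contractive (cprod s catom).
Proof. by case: s; [apply: contractive_lprod | apply: contractive_uprod]. Qed.

Lemma csum_no_size0 A B : no_size0 A -> no_size0 B -> no_size0 (csum A B).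
Proof. by move=> A0 B0 []. Qed.

Theorem dh_system_unique s (D K SC SX D' K' SC' SX' : comb_class) :
  dh_system s D K SC SX -> dh_system s D' K' SC' SX' ->
  [/\ class_iso D D', class_iso K K', class_iso SC SC' & class_iso SX SX'].
Proof.
move=> [[K0 SC0 SX0] [ED EK ESC ESX]] [[K0' SC0' SX0'] [ED' EK' ESC' ESX']].
have N1 : forall A B : sized, no_size0 A -> no_size0 B -> no_size0 (csum (csum catom A) B).
  by move=> A B A0 B0; do 2![apply: csum_no_size0 => //].
have step F A B (C C' : sized) n : contractive F -> no_size0 A -> no_size0 B ->
    class_iso C (F A) -> class_iso C' (F B) ->
    (forall m, m < n -> equinumerous_at A B m) -> equinumerous_at C C' n.
  move=> cF A0 B0 E E' H; apply: equi_trans (E n) _.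
  by apply: equi_trans (equi_sym (E' n)); apply: contractive_equi.
(* The three classes refer to one another, so their sizes are compared in one induction; [D] is then
   obtained from them. *)
have main n : [/\ equinumerous_at K K' n, equinumerous_at SC SC' n & equinumerous_at SX SX' n].
  have [m] := ubnP n; elim: m => // m IH in n * => nm.
  have IHn i : i < n -> [/\ equinumerous_at K K' i, equinumerous_at SC SC' i &
      equinumerous_at SX SX' i].
    by move=> lin; apply: IH; apply: leq_trans lin _; rewrite -ltnS.
  have sum3 (A B A' B' : sized) i : equinumerous_at A A' i -> equinumerous_at B B' i ->
      equinumerous_at (csum (csum catom A) B) (csum (csum catom A') B') i.
    by move=> EA EB; do 2![apply: equi_csum => //]; apply: equi_refl.
  split.
  - apply: (step _ _ _ _ _ n (@contractive_set_ge s) _ _ EK EK') => [||i /IHn[? ? ?]]; auto.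
  - apply: (step _ _ _ _ _ n (@contractive_set_ge s) _ _ ESC ESC') => [||i /IHn[? ? ?]]; auto.
  - apply: (step _ _ _ _ _ n (@contractive_seq_ge s) _ _ ESX ESX') => [||i /IHn[? ? ?]]; auto.
split=> n; try by case: (main n).
apply: (step _ _ _ _ _ n (@contractive_cprod s) _ _ ED ED') => [||i _].
- by do 2![apply: csum_no_size0 => //].
- by do 2![apply: csum_no_size0 => //].
by have [? ? ?] := main i; do 2![apply: equi_csum => //].
Qed.

(** * The solution given by canonical trees *)

Definition leaf_type (s : setting) : countType := if s is Labeled then nat else unit.

Definition labels_ok (s : setting) : seq (leaf_type s) -> bool :=
  if s is Labeled then fun l : seq nat => perm_eq l (iota 1 (size l)) else fun=> true.

Definition leaf1 (s : setting) : leaf_type s := if s is Labeled then 1 else tt.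

(** The predicate restricts the kind of the root: [pred1 k] selects one of the three classes,
    [predC1 k] the argument of its equation, with the leaf (kind 3) as the atom, and [predC1 3] the
    sum in the first equation. *)
Definition tree_ok s (P : pred nat) (t : tree (leaf_type s)) :=
  [&& wf t, canon t == t, labels_ok (leaves t) & P (kind t)].

Definition trees s (P : pred nat) : sized :=
  @Sized {t : tree (leaf_type s) | tree_ok P t} (fun t => size (leaves (val t))).

Definition mk_tree s P t (tP : @tree_ok s P t) : trees s P := exist _ t tP.

Lemma trees_no_size0 s P : no_size0 (trees s P).
Proof. by case=> t tP; case/and4P: (tP) => wt _ _ _; apply: wf_leaves. Qed.

Lemma wf_kind (T : countType) (t : tree T) : wf t -> kind t <= 3.
Proof. by case: t => //= k cs /andP[/ltnW]. Qed.

Lemma kind_leaf s (P : pred nat) (t : tree (leaf_type s)) : tree_ok P t -> kind t = 3 ->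
  t = Leaf (leaf1 s).
Proof.
case: t => [x|k cs] /and4P[wt _ lt _] /= k3; last by move: wt; rewrite /= k3.
by case: s x lt {wt} => [x /perm_mem/(_ x)|[]] //=; rewrite !inE eqxx => /esym/eqP->.
Qed.

Lemma leaf1_ok s (P : pred nat) : P 3 -> tree_ok P (Leaf (leaf1 s)).
Proof. by move=> P3; rewrite /tree_ok /= eqxx P3 andbT; case: s. Qed.

Lemma tree_emb_bij s (X : sized) (P : pred nat) (v : X -> tree (leaf_type s)) :
  injective v -> (forall x, tree_ok P (v x)) -> (forall t, tree_ok P t -> exists x, v x = t) ->
  (forall x, size (leaves (v x)) = size_of x) ->
  exists f : X -> trees s P, bijective f /\ forall x, size_of (f x) = size_of x.
Proof.
move=> vI vP vS vs.
have [||||f fb fR] := @rel_bijective X (trees s P) (fun x t => v x = val t).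
- by move=> x; exists (exist _ (v x) (vP x)).
- by move=> [t tP]; have [x vx] := vS t tP; exists x.
- by move=> x t t' e e'; apply: val_inj; exact: etrans (esym e) e'.
- by move=> x x' t e e'; apply: vI; exact: etrans e (esym e').
by exists f; split=> // x; rewrite /= -fR vs.
Qed.

Lemma tree_ok_kind s (P Q : pred nat) (t : tree (leaf_type s)) :
  tree_ok P t -> Q (kind t) -> tree_ok Q t.
Proof. by case/and4P=> wt ct lt _ Qt; apply/and4P. Qed.

Lemma tree_ok_pred s (P : pred nat) (t : tree (leaf_type s)) : tree_ok P t -> P (kind t).
Proof. by case/and4P. Qed.

Lemma tree_ok_sep s (P Q : pred nat) (t t' : tree (leaf_type s)) :
  (forall k, ~~ (P k && Q k)) -> tree_ok P t -> tree_ok Q t' -> t <> t'.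
Proof.
by move=> H /tree_ok_pred tP /tree_ok_pred tQ e; have := H (kind t); rewrite {2}e tP tQ.
Qed.

Lemma trees_csum_catom s (P Q R : pred nat) :
  R 3 -> ~~ P 3 -> ~~ Q 3 -> (forall k, k < 3 -> R k = P k || Q k) ->
  (forall k, ~~ (P k && Q k)) ->
  exists f : csum (csum catom (trees s P)) (trees s Q) -> trees s R,
    bijective f /\ forall x, size_of (f x) = size_of x.
Proof.
move=> R3 P3 Q3 RPQ PQ.
have okL := @leaf1_ok s (pred1 3) isT.
have dP k : ~~ (pred1 3 k && P k) by apply: contra P3 => /andP[/eqP->].
have dQ k : ~~ (pred1 3 k && Q k) by apply: contra Q3 => /andP[/eqP->].
apply: (@tree_emb_bij s (csum (csum catom (trees s P)) (trees s Q)) R (fun u => match u with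
  | inl (inl _) => Leaf (leaf1 s) | inl (inr t) => val t | inr t => val t end)).
- move=> [[[]|[t tP]]|[t tP]] [[[]|[t' tP']]|[t' tP']] //= e.
  + by case: (tree_ok_sep dP okL tP' e).
  + by case: (tree_ok_sep dQ okL tP' e).
  + by case: (tree_ok_sep dP okL tP (esym e)).
  + by congr (inl (inr _)); apply: val_inj.
  + by case: (tree_ok_sep PQ tP tP' e).
  + by case: (tree_ok_sep dQ okL tP (esym e)).
  + by case: (tree_ok_sep PQ tP' tP (esym e)).
  + by congr inr; apply: val_inj.
- have sub (P' : pred nat) (t : tree (leaf_type s)) : tree_ok P' t -> ~~ P' 3 ->
      (forall k, P' k -> P k || Q k) -> tree_ok R t.
    move=> tP P'3 H; apply: tree_ok_kind (tP) _; rewrite RPQ ?H ?(tree_ok_pred tP) //.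
    have := wf_kind (proj1 (andP tP)); rewrite leq_eqVlt => /predU1P[k3|//].
    by have := tree_ok_pred tP; rewrite k3 (negPf P'3).
  move=> [[_|[t tP]]|[t tP]] /=; first exact: leaf1_ok.
    by apply: sub tP _ _ => // k ->.
  by apply: sub tP _ _ => // k ->; rewrite orbT.
- move=> t tR; have := wf_kind (proj1 (andP tR)).
  rewrite leq_eqVlt => /predU1P[/(kind_leaf tR)->|k3]; first by exists (inl (inl tt)).
  have := tree_ok_pred tR; rewrite RPQ // => /orP[Pk|Qk].
    by exists (inl (inr (exist _ t (tree_ok_kind tR Pk)))).
  by exists (inr (exist _ t (tree_ok_kind tR Qk))).
- by case=> [[]|].
Qed.

Lemma trees_csum s (P Q N R : pred nat) :
  (forall k, k <= 3 -> R k = [|| P k, Q k | N k]) ->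
  (forall k, ~~ (P k && Q k)) -> (forall k, ~~ (P k && N k)) -> (forall k, ~~ (Q k && N k)) ->
  exists f : csum (csum (trees s P) (trees s Q)) (trees s N) -> trees s R,
    bijective f /\ forall x, size_of (f x) = size_of x.
Proof.
move=> RE PQ PN QN.
apply: (@tree_emb_bij s (csum (csum (trees s P) (trees s Q)) (trees s N)) R (fun u => match u with
  | inl (inl t) => val t | inl (inr t) => val t | inr t => val t end)).
- move=> [[[t tP]|[t tP]]|[t tP]] [[[t' tP']|[t' tP']]|[t' tP']] /= e;
    try by [congr (inl (inl _)); apply: val_inj | congr (inl (inr _)); apply: val_inj
           | congr inr; apply: val_inj].
  + by case: (tree_ok_sep PQ tP tP' e).
  + by case: (tree_ok_sep PN tP tP' e).
  + by case: (tree_ok_sep PQ tP' tP (esym e)).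
  + by case: (tree_ok_sep QN tP tP' e).
  + by case: (tree_ok_sep PN tP' tP (esym e)).
  + by case: (tree_ok_sep QN tP' tP (esym e)).
- have sub (P' : pred nat) (t : tree (leaf_type s)) : tree_ok P' t ->
      (forall k, P' k -> [|| P k, Q k | N k]) -> tree_ok R t.
    move=> tP H; apply: tree_ok_kind (tP) _.
    by rewrite RE ?H ?(tree_ok_pred tP) // wf_kind //; case/and4P: tP.
  by move=> [[[t tP]|[t tP]]|[t tP]] /=; apply: sub tP _ => k ->; rewrite ?orbT.
- move=> t tR; have := tree_ok_pred tR; rewrite RE; last by apply: wf_kind; case/and4P: tR.
  case/or3P=> Hk.
  + by exists (inl (inl (exist _ t (tree_ok_kind tR Hk)))).
  + by exists (inl (inr (exist _ t (tree_ok_kind tR Hk)))).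
  + by exists (inr (exist _ t (tree_ok_kind tR Hk))).
- by case=> [[]|].
Qed.

Section Arrange.
Variables (T : countType) (k : nat).
Implicit Types (l : seq (tree T)).

Definition kids_ok l := all (fun c => [&& wf c, canon c == c & kind c != k]) l.

Lemma kids_ok_canon l : kids_ok l -> [seq canon c | c <- l] = l.
Proof.
move/allP=> H; rewrite -[RHS]map_id; apply/eq_in_map => c /H/and3P[_ /eqP-> _]; done.
Qed.

Lemma kids_ok_node l : k < 3 -> 1 < size l -> kids_ok l ->
  wf (Node k (arrange k l)) /\ canon (Node k (arrange k l)) = Node k (arrange k l).
Proof.
move=> k3 l2 ok; have p := perm_arrange k l; split.
  rewrite /= k3 (perm_size p) l2 !(perm_all _ p) /=; apply/andP; split.
    by apply: sub_all ok => c /and3P[].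
  by apply: sub_all ok => c /and3P[].
by rewrite /= kids_ok_canon ?arrange_id // /kids_ok (perm_all _ p).
Qed.

Lemma kids_ok_surj t : wf t -> canon t = t -> kind t = k -> k < 3 ->
  exists l, [/\ t = Node k (arrange k l), 1 < size l & kids_ok l].
Proof.
case: t => [x|k' cs] /= wt ct kk'; first by rewrite -kk'.
rewrite {k'}kk' in wt ct *; case: ct => ct k3; exists [seq canon c | c <- cs].
case/and4P: wt => _ s2 ka wa; split; rewrite ?ct ?size_map //.
rewrite /kids_ok all_map; apply/allP=> c cin /=.
by rewrite wf_canon (allP wa) // canon_id eqxx kind_canon (allP ka).
Qed.

Lemma leaves_arrange l : perm_eq (leaves (Node k (arrange k l))) (leaves (Node k l)).
Proof. by apply: perm_flatten; apply: perm_map; apply: perm_arrange. Qed.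

Lemma size_leaves_node l : size (leaves (Node k l)) = \sum_(c <- l) size (leaves c).
Proof. by rewrite /= size_flatten /shape -map_comp sumnE big_map. Qed.

End Arrange.

Lemma arrange_inj (T : countType) k (l l' : seq (tree T)) :
  arrange k l = arrange k l' -> perm_eq l l'.
Proof. by move=> e; rewrite -(permPl (perm_arrange k l)) e perm_arrange. Qed.

Lemma arrange_seq (T : countType) k (l : seq (tree T)) : 1 < k -> arrange k l = l.
Proof. by move=> k1; rewrite /arrange ltnNge k1. Qed.

(** * The unlabeled equations for canonical trees *)

Section UnlabeledSystem.
Variable k : nat.
Hypothesis k3 : k < 3.
Let A := trees Unlabeled (predC1 k).

Lemma unlabeled_kids_ok (l : seq A) : kids_ok k (map val l).
Proof.
rewrite /kids_ok all_map; apply/allP=> -[t tP] _ /=.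
by case/and4P: tP => wt ct _ kt; apply/and3P.
Qed.

Lemma unlabeled_node_ok (l : seq A) : 1 < size l ->
  tree_ok (s := Unlabeled) (pred1 k) (Node k (arrange k (map val l))).
Proof.
move=> l2; have [|w c] := @kids_ok_node _ k (map val l) k3 _ (unlabeled_kids_ok l).
  by rewrite size_map.
by apply/and4P; split; rewrite ?c //=.
Qed.

Lemma unlabeled_node_size (l : seq A) :
  size (leaves (Node k (arrange k (map val l)))) = \sum_(a <- l) size_of a.
Proof. by rewrite (perm_size (leaves_arrange _ _)) size_leaves_node big_map. Qed.

Lemma unlabeled_node_surj (t : trees Unlabeled (pred1 k)) :
  exists2 l : seq A, 1 < size l & val t = Node k (arrange k (map val l)).
Proof.
case: t => t tP /=; have /and4P[wt /eqP ct _ /eqP kt] := tP.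
have [l [-> l2 /allP lok]] := kids_ok_surj wt ct kt k3.
have [|l' e] := @map_surj A _ val l; last first.
  by exists l'; rewrite ?e // -(size_map val) e.
move=> c /lok/and3P[wc cc kc].
have cP : tree_ok (s := Unlabeled) (predC1 k) c by apply/and4P; split.
by exists (exist _ c cP).
Qed.

Lemma trees_uset n : k < 2 -> equinumerous_at (trees Unlabeled (pred1 k)) (uset 2 A) n.
Proof.
move=> k2; apply: equi_sym; apply: (@equi_rel (uset 2 A) (trees Unlabeled (pred1 k)) n
  (fun m t => val t = Node k (arrange k (map val (enum_mset (val m)))))) => /=.
- move=> [m m2] mn; exists (mk_tree (unlabeled_node_ok m2)) => //=.
  by rewrite unlabeled_node_size.
- move=> t tn; have [l l2 e] := unlabeled_node_surj t.
  have [m p] := uset_of l2; exists m.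
    by rewrite (perm_big _ p) -unlabeled_node_size -e.
  rewrite e; congr Node; apply: (arrange_perm k2).
  by apply: perm_map; rewrite perm_sym.
- by move=> m t t' _ _ _ e e'; apply: val_inj; exact: etrans e (esym e').
move=> m m' t _ _ _ e e'; apply/val_inj/mset_perm_inj.
by case: (etrans (esym e) e') => /arrange_inj/(perm_map_inj val_inj).
Qed.

Lemma trees_useq n : k = 2 -> equinumerous_at (trees Unlabeled (pred1 k)) (useq 2 A) n.
Proof.
move=> k2; apply: equi_sym; apply: (@equi_rel (useq 2 A) (trees Unlabeled (pred1 k)) n
  (fun m t => val t = Node k (arrange k (map val (val m))))) => /=.
- move=> [m m2] mn; exists (mk_tree (unlabeled_node_ok m2)) => //=.
  by rewrite unlabeled_node_size.
- move=> t tn; have [l l2 e] := unlabeled_node_surj t.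
  by exists (exist _ l l2); rewrite //= -unlabeled_node_size -e.
- by move=> m t t' _ _ _ e e'; apply: val_inj; exact: etrans e (esym e').
move=> m m' t _ _ _ e e'; apply/val_inj.
case: (etrans (esym e) e'); rewrite !arrange_seq ?k2 //.
exact/inj_map/val_inj.
Qed.
End UnlabeledSystem.

(** * Order-preserving relabeling and the labeled equations *)

Section Relabel.
Implicit Types (L : {fset nat}%fset).

(** The increasing bijection from 1, ..., |L| onto [L], followed by its inverse; labels start at 1
    and positions at 0, hence the shifts. *)
Definition lab L i := nth 0 (sort leq (enum_fset L)) i.-1.
Definition unlab L x := (index x (sort leq (enum_fset L))).+1.

Lemma lab_iota L : [seq lab L i | i <- iota 1 #|` L|%fset] = sort leq (enum_fset L).
Proof.
rewrite (iotaDl 1 0) -map_comp -[RHS](mkseq_nth 0) size_sort.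
by apply/eq_in_map => i _.
Qed.

Lemma unlabK L : {in enum_fset L, cancel (unlab L) (lab L)}.
Proof. by move=> x xL; rewrite /lab /unlab /= nth_index // mem_sort. Qed.

Lemma labK L : {in iota 1 #|` L|%fset, cancel (lab L) (unlab L)}.
Proof.
move=> [|i]; rewrite mem_iota //= add1n ltnS => il.
by rewrite /lab /unlab /= index_uniq ?sort_uniq ?fset_uniq // size_sort.
Qed.

Lemma unlab_iota L : [seq unlab L x | x <- sort leq (enum_fset L)] = iota 1 #|` L|%fset.
Proof.
by rewrite -lab_iota -map_comp -[RHS]map_id; apply/eq_in_map => i /labK.
Qed.

Variable P : pred nat.
Let A := trees Labeled P.

(** The sort is repeated because the order of children depends on their labels, even under an
    increasing relabeling. *)
Definition relabel (p : relabeled A) : tree nat := canon (tmap (lab p.1) (val p.2)).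

Lemma relabel_leaves (p : relabeled A) : relabeled_ok p ->
  perm_eq (leaves (relabel p)) (enum_fset p.1).
Proof.
case: p => L [t tP]; rewrite /relabeled_ok /= => /eqP cL; have /and4P[_ _ /= lt _] := tP.
apply: perm_trans (leaves_canon _) _; rewrite leaves_tmap.
apply: perm_trans (perm_map _ lt) _.
by rewrite -cL lab_iota perm_sort.
Qed.

Lemma relabel_kids_ok (p : relabeled A) :
  [&& wf (relabel p), canon (relabel p) == relabel p & P (kind (relabel p))].
Proof.
case: p => L [t tP]; have /and4P[wt _ _ kt] := tP.
by rewrite /relabel wf_canon wf_tmap wt canon_id eqxx kind_canon kind_tmap.
Qed.

(** The leaves of the relabeled tree determine the label set, and renumbering them by rank recovers
    the standard tree. *)
Lemma relabel_inj (p q : relabeled A) : relabeled_ok p -> relabeled_ok q ->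
  relabel p = relabel q -> p = q.
Proof.
move=> okp okq e.
have eL : p.1 = q.1.
  apply: fset_perm_inj; rewrite -(permPl (relabel_leaves okp)) e.
  exact: relabel_leaves.
have back (r : relabeled A) : relabeled_ok r -> canon (tmap (unlab r.1) (relabel r)) = val r.2.
  case: r => L [t tP]; rewrite /relabeled_ok /relabel /= => /eqP cL.
  have /and4P[_ /eqP ct /= lt _] := tP.
  rewrite canon_tmap tmap_comp tmap_id_in // => i; rewrite (perm_mem lt) -cL.
  exact: labK.
case: p q okp okq e eL => [L a] [M b] okp okq e /= LM; congr pair => //.
by apply: val_inj; rewrite -(back _ okp) -(back _ okq) e /= LM.
Qed.

Lemma relabel_surj (t : tree nat) : wf t -> canon t = t -> P (kind t) -> uniq (leaves t) ->
  exists2 p : relabeled A, relabeled_ok p & relabel p = t.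
Proof.
move=> wt ct kt ut; have [L pL] := fset_of_uniq ut.
pose u := canon (tmap (unlab L) t).
have lu : perm_eq (leaves u) (iota 1 #|` L|%fset).
  apply: perm_trans (leaves_canon _) _; rewrite leaves_tmap -unlab_iota.
  by apply: perm_map; rewrite perm_sym perm_sort.
have su : size (leaves u) = #|` L|%fset by rewrite (perm_size lu) size_iota.
have uP : tree_ok (s := Labeled) P u.
  by rewrite /tree_ok /u wf_canon wf_tmap wt canon_id eqxx kind_canon kind_tmap kt /= -/u su lu.
exists (L, exist _ u uP); first by rewrite /relabeled_ok /= su.
rewrite /relabel /= /u canon_tmap tmap_comp tmap_id_in // => x.
by rewrite -(perm_mem pL); apply: unlabK.
Qed.

End Relabel.

Section LabeledSystem.
Variable k : nat.
Hypothesis k3 : k < 3.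
Let A := trees Labeled (predC1 k).
Implicit Types (l : seq (relabeled A)).

Lemma labeled_leaves l : all (@relabeled_ok A) l ->
  perm_eq (leaves (Node k (map (@relabel _) l))) (flatten [seq enum_fset L | L <- [seq p.1 | p <- l]]).
Proof.
elim: l => //= p l IH /andP[okp okl].
by apply: perm_cat; [apply: relabel_leaves | apply: IH].
Qed.

Lemma labeled_node_size l : all (@relabeled_ok A) l ->
  size (leaves (Node k (arrange k (map (@relabel _) l)))) = \sum_(p <- l) size_of p.2.
Proof.
move=> okl; rewrite (perm_size (leaves_arrange _ _)) size_leaves_node big_map.
apply: eq_big_seq => p pl; have okp := allP okl _ pl.
by rewrite (perm_size (relabel_leaves okp)) (eqP okp).
Qed.

Lemma labeled_node_ok l : 1 < size l -> well_labeled l ->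
  tree_ok (s := Labeled) (pred1 k) (Node k (arrange k (map (@relabel _) l))).
Proof.
move=> l2 /andP[okl spl].
have kok : kids_ok k (map (@relabel _) l).
  by rewrite /kids_ok all_map; apply/allP=> p _; apply: relabel_kids_ok.
have [|w c] := @kids_ok_node _ k (map (@relabel _) l) k3 _ kok; first by rewrite size_map.
apply/and4P; split; rewrite ?c //=; rewrite labeled_node_size //.
apply: perm_trans (leaves_arrange _ _) _.
exact: perm_trans (labeled_leaves okl) spl.
Qed.

Lemma labeled_node_surj (t : trees Labeled (pred1 k)) :
  exists l, [/\ 1 < size l, well_labeled l & val t = Node k (arrange k (map (@relabel _) l))].
Proof.
case: t => t tP /=; have /and4P[wt /eqP ct /= lt /eqP kt] := tP.
have [r [e r2 /allP rok]] := kids_ok_surj wt ct kt k3.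
have ur : uniq (leaves (Node k r)).
  by rewrite -(perm_uniq (leaves_arrange k r)) -e (perm_uniq lt) iota_uniq.
have [l okl el] : exists2 l, all (@relabeled_ok A) l & map (@relabel _) l = r.
  elim: (r) ur rok => [|c r' IH]; first by exists [::].
  rewrite leaves_cons cat_uniq => /and3P[uc _ ur'] rok.
  have [|l okl el] := IH ur'; first by move=> d dr; apply: rok; rewrite inE dr orbT.
  have /and3P[wc /eqP cc kc] := rok c (mem_head _ _).
  have [p okp ep] := @relabel_surj (predC1 k) c wc cc kc uc.
  by exists (p :: l); rewrite /= ?okp // ep el.
exists l; rewrite -(size_map (@relabel _)) el; split=> //.
apply/andP; split=> //; rewrite /label_split -(permPl (labeled_leaves okl)) el.
rewrite -labeled_node_size // el -e -(permPr lt) e perm_sym.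
exact: leaves_arrange.
Qed.

Lemma trees_lset n : k < 2 -> equinumerous_at (trees Labeled (pred1 k)) (lset 2 A) n.
Proof.
move=> k2; have A0 : no_size0 A by apply: trees_no_size0.
apply: equi_sym; apply: (@equi_rel (lset 2 A) (trees Labeled (pred1 k)) n
  (fun m t => val t = Node k (arrange k (map (@relabel _) (enum_fset (val m)))))) => /=.
- move=> [m mP] mn; have [m2 mw] := andP mP.
  exists (mk_tree (labeled_node_ok m2 mw)) => //=.
  by rewrite labeled_node_size //; case/andP: mw.
- move=> t tn; have [l [l2 lw e]] := labeled_node_surj t.
  have [m p] := lset_of A0 l2 lw; exists m.
    by rewrite (perm_big _ p) -labeled_node_size -?e //; case/andP: lw.
  rewrite e; congr Node; apply: (arrange_perm k2).
  by apply: perm_map; rewrite perm_sym.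
- by move=> m t t' _ _ _ e e'; apply: val_inj; exact: etrans e (esym e').
move=> [m mP] [m' mP'] t _ _ _ /= e e'; apply/val_inj/fset_perm_inj => /=.
case: (etrans (esym e) e') => /arrange_inj/perm_mem p.
have [/allP okm /allP okm'] :
    all (@relabeled_ok A) (enum_fset m) /\ all (@relabeled_ok A) (enum_fset m').
  by case/and3P: mP => _ -> _; case/and3P: mP' => _ -> _.
apply: uniq_perm; rewrite ?fset_uniq // => x; apply/idP/idP => xm.
  have : relabel x \in map (@relabel _) (enum_fset m') by rewrite -p map_f.
  by case/mapP=> y ym' /relabel_inj-> //; [apply: okm | apply: okm'].
have : relabel x \in map (@relabel _) (enum_fset m) by rewrite p map_f.
by case/mapP=> y ym /relabel_inj-> //; [apply: okm' | apply: okm].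
Qed.

Lemma trees_lseq n : k = 2 -> equinumerous_at (trees Labeled (pred1 k)) (lseq 2 A) n.
Proof.
move=> k2; apply: equi_sym; apply: (@equi_rel (lseq 2 A) (trees Labeled (pred1 k)) n
  (fun m t => val t = Node k (arrange k (map (@relabel _) (val m))))) => /=.
- move=> [m mP] mn; have [m2 mw] := andP mP.
  exists (mk_tree (labeled_node_ok m2 mw)) => //=.
  by rewrite labeled_node_size //; case/andP: mw.
- move=> t tn; have [l [l2 lw e]] := labeled_node_surj t.
  have lP : (1 < size l) && well_labeled l by rewrite l2.
  exists (exist _ l lP) => //=.
  by rewrite -labeled_node_size -?e //; case/andP: lw.
- by move=> m t t' _ _ _ e e'; apply: val_inj; exact: etrans e (esym e').
move=> [m mP] [m' mP'] t _ _ _ /= e e'; apply/val_inj => /=.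
case: (etrans (esym e) e'); rewrite !arrange_seq ?k2 //.
case/and3P: mP => _ okm _; case/and3P: mP' => _ okm' _.
exact: (inj_in_map (A := @relabeled_ok A) (@relabel_inj _)).
Qed.
End LabeledSystem.

Lemma trees_set_ge s k n : k < 2 ->
  equinumerous_at (trees s (pred1 k)) (set_ge s 2 (trees s (predC1 k))) n.
Proof. by move=> k2; have k3 := ltnW k2; case: s; [apply: trees_lset | apply: trees_uset]. Qed.

Lemma trees_seq_ge s n :
  equinumerous_at (trees s (pred1 2)) (seq_ge s 2 (trees s (predC1 2))) n.
Proof. by case: s; [apply: trees_lseq | apply: trees_useq]. Qed.

(** * Finitely many trees of each size *)

Section Finiteness.
Variable T : countType.
Implicit Types (t : tree T).

Fixpoint seqs_upto (E : seq (tree T)) m : seq (seq (tree T)) :=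
  if m is m'.+1 then [::] :: [seq c :: cs | c <- E, cs <- seqs_upto E m'] else [:: [::]].

Lemma mem_seqs_upto E m cs : size cs <= m -> {subset cs <= E} -> cs \in seqs_upto E m.
Proof.
elim: m cs => [|m IH] [|c cs] //= cm sub; rewrite inE /=; apply/allpairsP.
exists (c, cs); split=> //=; first by apply: sub; rewrite mem_head.
by apply: IH => // d dcs; apply: sub; rewrite inE dcs orbT.
Qed.

(** A well-formed node has at least two children, each with a leaf. So every child has fewer leaves
    than the node, and there are at most as many children as leaves. *)
Lemma wf_trees_finite (E : seq T) n : exists e : seq (tree T),
  forall t, wf t -> {subset leaves t <= E} -> size (leaves t) <= n -> t \in e.
Proof.
elim: n => [|n [e He]].
  by exists [::] => t /wf_leaves; rewrite lt0n leqn0 => /negPf->.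
exists ([seq Leaf x | x <- E] ++ [seq Node k cs | k <- iota 0 3, cs <- seqs_upto e n.+1]).
move=> [x|k cs] wt sub sz; rewrite mem_cat; apply/orP.
  by left; apply: map_f; apply: sub; rewrite mem_head.
right; apply/allpairsP; exists (k, cs); case/and4P: (wt) => k3 s2 _ /allP wcs.
have pos c : c \in cs -> 0 < size (leaves c) by move/wcs/wf_leaves.
have sum_ge (r : seq (tree T)) : {subset r <= cs} -> size r <= \sum_(c <- r) size (leaves c).
  move=> rs; rewrite -sum1_size !big_seq; apply: leq_sum => c /rs; exact: pos.
rewrite size_leaves_node in sz; split=> //; first by rewrite mem_iota.
apply: mem_seqs_upto; first by apply: leq_trans sz; apply: sum_ge.
move=> c cin; apply: He; first exact: wcs.
  move=> x xc; apply: sub; apply/flattenP; exists (leaves c) => //; exact: map_f.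
rewrite -ltnS; apply: leq_trans sz; rewrite (perm_big _ (perm_to_rem cin)) big_cons /=.
rewrite -addn1 leq_add2l; apply: leq_trans (sum_ge _ (@mem_rem _ _ _)).
by rewrite size_rem //; case: (size cs) s2 => [|[]].
Qed.
End Finiteness.

Lemma trees_finite s P n : exists e : seq (trees s P),
  forall t : trees s P, size_of t = n -> t \in e.
Proof.
pose E : seq (leaf_type s) := match s with Labeled => iota 1 n | Unlabeled => [:: tt] end.
have [e He] := wf_trees_finite E n.
exists (pmap insub e) => -[t tP] /= tn; rewrite mem_pmap_sub /=.
have /and4P[wt _ lt _] := tP; apply: He; rewrite ?tn //.
by rewrite /E; case: (s) t lt tn {wt tP} => [t /= /perm_mem lt <-|t _ _ []] x; rewrite ?lt.
Qed.

Definition tree_class s P : comb_class := CombClass (@trees_finite s P).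

(** * Rooted graphs and canonical trees *)

Lemma represents_size n (g : rooted n) t : represents g t -> (size (leaves t)).+1 = n.
Proof.
case=> _ u a _; rewrite -[LHS]/(size (g.2 :: leaves t)) -[RHS]card_ord cardE.
by apply: perm_size; apply: uniq_perm; rewrite ?enum_uniq // => x; rewrite a mem_enum.
Qed.

Lemma represents_kind n (g : rooted n) t : 2 < n -> represents g t -> kind t != 3.
Proof.
move=> n2 rt; have := represents_size rt; case: rt => wt _ _ _.
case: t wt => [x _ /= n2'|k cs /andP[k3 _] _]; first by rewrite -n2' in n2.
by rewrite /= ltn_eqF.
Qed.

Definition mk_labeled n (g : rooted n) (dg : rooted_dh g) : labeled_dh :=
  existT _ n (exist _ g dg).

Definition mk_unlabeled n (C : {set rooted n})
    (CP : C \in equivalence_partition (@rooted_iso n) [set g | rooted_dh g]) : unlabeled_dh :=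
  existT _ n (exist _ C CP).

(** The atom stands for the root, and a class is determined by the canonical shape common to the
    trees of its members. *)
Lemma unlabeled_dh_uprod n : 2 < n ->
  equinumerous_at unlabeled_dh (uprod catom (trees Unlabeled (predC1 3))) n.
Proof.
move=> n2; apply: (@equi_rel unlabeled_dh (uprod catom (trees Unlabeled (predC1 3))) n
  (fun C p => exists g t, [/\ g \in val (tagged C), represents g t &
                              canon (unlabel t) = val p.2])) => /=.
- move=> [m [C CP]] /= mn; rewrite {m}mn in C CP *.
  have /imsetP[g] := CP; rewrite inE => dg eC.
  have [t rt] := dh_represents (ltnW n2) dg.
  have tP : tree_ok (s := Unlabeled) (predC1 3) (canon (unlabel t)).
    apply/and4P; split=> //=; rewrite ?canon_id ?wf_canon ?wf_tmap //; first by case: rt.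
    by rewrite kind_canon kind_tmap (represents_kind n2 rt).
  exists (tt, mk_tree tP) => /=.
    by rewrite (perm_size (leaves_canon _)) size_leaves_unlabel; exact: represents_size rt.
  exists g, t; split=> //; rewrite eC !inE dg; apply/(rooted_isoP rt rt); done.
- move=> [[] [u uP]] /= un; have /and4P[wu /eqP cu _ ku] := uP.
  case: n n2 un => // n n2 un.
  (* Any placement of the vertices represents the class; here the root is [ord0] and the other
     vertices fill the leaves in order. *)
  have [|t tu lt] := @unlabel_surj 'I_n.+1 u (behead (enum 'I_n.+1)).
    by rewrite size_behead size_enum_ord; case: un.
  have wt : wf t by rewrite -(wf_tmap (fun=> tt)) tu.
  have e0 : ord0 :: leaves t = enum 'I_n.+1 by rewrite lt enum_ordSl.
  have [g gr rg] : exists2 g, g.2 = ord0 & represents g t.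
    by apply: represents_exist; rewrite ?e0 ?enum_uniq // => x; rewrite mem_enum.
  have dg := represents_dh rg.
  have CP : [set h in [set h | rooted_dh h] | rooted_iso g h]
      \in equivalence_partition (@rooted_iso n.+1) [set h | rooted_dh h].
    by apply/imsetP; exists g; rewrite ?inE.
  exists (mk_unlabeled CP) => //.
  exists g, t; split=> //=; last by rewrite tu cu.
  by rewrite !inE dg; apply/(rooted_isoP rg rg).
- move=> [m [C CP]] [[] u] [[] u'] /= _ _ _ [g [t [gC rt eu]]] [g' [t' [gC' rt' eu']]].
  congr pair; apply: val_inj; rewrite /= -eu -eu'.
  have /imsetP[h] := CP; rewrite inE => dh eC; move: gC gC'; rewrite eC !inE.
  case/andP=> dg ig /andP[dg' ig'].
  have m1 : 1 < m.
    have e := represents_size rt; case: rt => wt _ _ _.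
    exact: leq_trans (wf_leaves wt : 1 < (size (leaves t)).+1) (eq_leq e).
  have [th rh] := dh_represents m1 dh.
  by rewrite -(rooted_isoP rh rt ig) -(rooted_isoP rh rt' ig').
- move=> [m [C CP]] [m' [C' CP']] [[] u] /= mn mn' _.
  move: mn' C' CP'; rewrite -mn => -> {m'} C' CP' [g [t [gC rt eu]]] [g' [t' [gC' rt' eu']]].
  rewrite mn in C CP C' CP' g t gC rt eu g' t' gC' rt' eu' *.
  congr existT; apply: val_inj => /=.
  have /imsetP[h] := CP; rewrite inE => dh eC; have /imsetP[h'] := CP'; rewrite inE => dh' eC'.
  have n1 := ltnW n2.
  have [th rh] := dh_represents n1 dh; have [th' rh'] := dh_represents n1 dh'.
  move: gC gC'; rewrite eC eC' !inE => /andP[dg ig] /andP[dg' ig'].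
  have hh' : canon (unlabel th) = canon (unlabel th').
    rewrite (rooted_isoP rh rt ig) (rooted_isoP rh' rt' ig') eu eu'; done.
  apply/setP=> x; rewrite !inE; case dx: (rooted_dh x) => //=.
  have [tx rx] := dh_represents n1 dx.
  by apply/(rooted_isoP rh rx)/(rooted_isoP rh' rx); rewrite hh'.
Qed.

(** Vertices are numbered from 0 and labels from 1, whence the shift by one. The atom carries the
    label of the root, and the tree uses the remaining labels. *)
Lemma labeled_dh_lprod n : 2 < n ->
  equinumerous_at labeled_dh (lprod catom (trees Labeled (predC1 3))) n.
Proof.
move=> n2; apply: (@equi_rel labeled_dh (lprod catom (trees Labeled (predC1 3))) n
  (fun u p => exists t, [/\ represents (val (tagged u)) t,
     enum_fset (val p).1.1 = [:: (val (tagged u)).2.+1] &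
     canon (tmap (fun i : 'I_(tag u) => i.+1) t) = relabel (val p).2])) => /=.
- move=> [m [g dg]] /= mn; rewrite {m}mn in g dg *.
  have [t rt] := dh_represents (ltnW n2) dg.
  have sI : injective (fun i : 'I_n => i.+1) by move=> i j [] /ord_inj.
  have kt := represents_kind n2 rt; have sz := represents_size rt.
  have [wt ut at_ _] := rt; have [rnt ult] := andP (ut : (g.2 \notin leaves t) && uniq (leaves t)).
  pose t' := canon (tmap (fun i : 'I_n => i.+1) t).
  have lt' : perm_eq (leaves t') [seq i.+1 | i : 'I_n <- leaves t].
    by rewrite -leaves_tmap; apply: leaves_canon.
  have [|||| p okp ep] := @relabel_surj (predC1 3) t'.
  + by rewrite wf_canon wf_tmap.
  + exact: canon_id.
  + by rewrite kind_canon kind_tmap.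
  + by rewrite (perm_uniq lt') map_inj_uniq.
  have [L pL] := @fset_of_uniq _ [:: g.2.+1] isT.
  have eL : enum_fset L = [:: g.2.+1] by apply: perm_small_eq.
  have sp : size_of p.2 = size (leaves t).
    by rewrite -(eqP okp) -(perm_size (relabel_leaves okp)) ep (perm_size lt') size_map.
  have qP : [&& @relabeled_ok catom (L, tt), @relabeled_ok _ p &
      label_split [:: L; p.1] (1 + size_of p.2)].
    apply/and3P; split=> //; first by rewrite /relabeled_ok /= eL.
    rewrite sp add1n sz /label_split /= eL cats0.
    rewrite (perm_trans (_ : perm_eq _ [seq i.+1 | i : 'I_n <- g.2 :: leaves t])) //.
      rewrite /= perm_cons; apply: perm_trans lt'.
      by rewrite /t' -/t' -ep perm_sym relabel_leaves.
    have -> : iota 1 n = [seq i.+1 | i : 'I_n <- enum 'I_n].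
      by rewrite (map_comp succn) val_enum_ord (iotaDl 1 0).
    apply: perm_map; apply: uniq_perm; rewrite ?enum_uniq // => x.
    by rewrite at_ mem_enum.
  by exists (exist _ ((L, tt), p) qP); [exact: etrans (congr1 (addn 1) sp) sz | exists t].
- move=> [[[L []] p] qP] /= pn; have /and3P[okL okp sL] := qP.
  case: n n2 pn => // n n2 pn.
  have [x eL] : exists x, enum_fset L = [:: x].
    by move: okL; rewrite /relabeled_ok /=; case: (enum_fset L) => [|x []] // _; exists x.
  (* The inverse of the shift; the arbitrary values of [inord] out of range do not matter, since the
     labels lie between 1 and [n.+1]. *)
  pose f i : 'I_n.+1 := inord i.-1.
  have fK : {in iota 1 n.+1, forall i, (f i).+1 = i}.
    by move=> [|i]; rewrite mem_iota //= add1n ltnS => il; rewrite /f /= inordK.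
  have all_labels : perm_eq (x :: leaves (relabel p)) (iota 1 n.+1).
    have {}sL : label_split [:: L; p.1] n.+1 by rewrite -pn.
    move: sL; rewrite /label_split /= eL cats0; apply: perm_trans.
    by rewrite perm_cons relabel_leaves.
  have mem_labels i : i \in x :: leaves (relabel p) -> (f i).+1 = i.
    by rewrite (perm_mem all_labels); apply: fK.
  pose t := tmap f (relabel p).
  have ft : tmap (fun i : 'I_n.+1 => i.+1) t = relabel p.
    by rewrite tmap_comp tmap_id_in // => i il; rewrite /= mem_labels // inE il orbT.
  have /and3P[wp /eqP cp _] := relabel_kids_ok p.
  have et : f x :: leaves t = [seq f i | i <- x :: leaves (relabel p)] by rewrite leaves_tmap.
  have [g gr rg] : exists2 g, g.2 = f x & represents g t.
    apply: represents_exist; first by rewrite wf_tmap.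
      rewrite et map_inj_in_uniq ?(perm_uniq all_labels) ?iota_uniq // => i j iin jin fij.
      by rewrite -(mem_labels i iin) -(mem_labels j jin) fij.
    move=> i; rewrite et; have -> : i = f i.+1 by rewrite /f /= inord_val.
    by apply: map_f; rewrite (perm_mem all_labels) mem_iota /= add1n ltnS ltn_ord.
  exists (mk_labeled (represents_dh rg)) => //; exists t; split=> //=.
    by rewrite gr eL mem_labels ?mem_head.
  by rewrite ft cp.
- move=> [m [g dg]] [[[L []] p] qP] [[[L' []] p'] qP'] /= _ _ _.
  move=> [t [rt eL et]] [t' [rt' eL' et']]; apply: val_inj => /=.
  have /and3P[_ okp _] := qP; have /and3P[_ okp' _] := qP'.
  congr ((_, _), _); first by apply: fset_perm_inj; rewrite eL eL'.
  apply: (relabel_inj okp okp'); rewrite -et -et'.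
  by rewrite -canon_tmap (represents_unique rt rt') canon_tmap.
- move=> [m [g dg]] [m' [g' dg']] [[[L []] p] qP] /= mn mn' _.
  move: mn' g' dg'; rewrite -mn => -> {m'} g' dg' [t [rt eL et]] [t' [rt' eL' et']].
  congr existT; apply: val_inj => /=.
  have gg' : g.2 = g'.2 by apply: ord_inj; move: eL'; rewrite eL => -[].
  (* Undoing the shift recovers each tree up to reordering. The case [m = 0] is excluded because a
     root is an element of ['I_m]. *)
  have e : canon t = canon t'.
    clear eL eL' gg' dg' dg mn qP rt rt'.
    case: m g g' t t' et et' => [[? []]//|m] _ _ t t' et et'.
    have back (u : tree 'I_m.+1) :
        canon (tmap (fun i => inord i.-1) (canon (tmap (fun i : 'I_m.+1 => i.+1) u))) = canon u.
      by rewrite canon_tmap tmap_comp tmap_id_in // => i _; rewrite /= inord_val.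
    by rewrite -(back t) et -et' back.
  apply: (represents_inj _ rt' gg'); apply: (represents_eqv rt); first by case: rt'.
  exact: eqv_canon_eq.
Qed.

Lemma rooted_dh_cprod s n : 2 < n ->
  equinumerous_at (rooted_dh_class s) (cprod s catom (trees s (predC1 3))) n.
Proof. by case: s; [apply: labeled_dh_lprod | apply: unlabeled_dh_uprod]. Qed.

Lemma rooted_dh_finite s n : exists e : seq (rooted_dh_class s),
  forall u : rooted_dh_class s, size_of u = n -> u \in e.
Proof.
case: s.
  exists [seq existT _ n x | x : {g : rooted n | rooted_dh g} <- enum {: {g : rooted n | rooted_dh g}}].
  by move=> [m x] /= mn; subst m; rewrite map_f ?mem_enum.
exists [seq existT _ n x | x <- enum {: {C : {set rooted n} |
  C \in equivalence_partition (@rooted_iso n) [set g | rooted_dh g]}}].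
by move=> [m x] /= mn; subst m; rewrite map_f ?mem_enum.
Qed.

(** Rooted graphs of sizes 1 and 2 exist but the first equation gives none, so they must be left out
    of a solution. *)
Definition rooted_dh_ge3 s : sized :=
  @Sized {u : rooted_dh_class s | 2 < size_of u} (fun u => size_of (val u)).

Lemma rooted_dh_ge3_finite s n : exists e : seq (rooted_dh_ge3 s),
  forall u : rooted_dh_ge3 s, size_of u = n -> u \in e.
Proof.
have [e He] := rooted_dh_finite s n; exists (pmap insub e) => -[u u3] /= un.
by rewrite mem_pmap_sub /= He.
Qed.

Lemma rooted_dh_ge3_equi s n : 2 < n -> equinumerous_at (rooted_dh_class s) (rooted_dh_ge3 s) n.
Proof.
move=> n2; apply: equi_sym; apply: (@equi_map (rooted_dh_ge3 s) (rooted_dh_class s) n val) => //.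
  exact: val_inj.
move=> u un; have u3 : 2 < size_of u by rewrite un.
by exists (exist _ u u3).
Qed.

Lemma cprod_catom_size s A (p : cprod s catom A) :
  exists a : A, size_of p = (size_of a).+1.
Proof. by case: s p => [[[p1 p2] pP]|[[] a]]; [exists p2.2 | exists a]. Qed.

Lemma trees_dh_system s : dh_system s (CombClass (@rooted_dh_ge3_finite s))
  (tree_class s (pred1 0)) (tree_class s (pred1 1)) (tree_class s (pred1 2)).
Proof.
have N := @trees_no_size0 s.
split; first by split; apply: N.
split=> n /=.
- have [f [fb fs]] : exists f :
      csum (csum (trees s (pred1 0)) (trees s (pred1 1))) (trees s (pred1 2)) ->
      trees s (predC1 3), bijective f /\ forall x, size_of (f x) = size_of x.
    by apply: trees_csum => [[|[|[|[]]]]//|k|k|k]; apply/andP => -[/eqP->].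
  apply: equi_trans (equi_sym (contractive_bij n (@contractive_cprod s) (N _) fb fs)).
  have [n2|n2] := ltnP 2 n.
    exact: equi_trans (equi_sym (rooted_dh_ge3_equi s n2)) (rooted_dh_cprod s n2).
  (* In sizes at most 2 both sides are empty: a tree other than a leaf has at least two leaves, and
     the atom adds one. *)
  apply: equi_empty => [[u u3]|p] /=; first by apply: contraTN u3 => /eqP->; rewrite -leqNgt.
  have [[t tP] ->] := cprod_catom_size p; rewrite /= neq_ltn; apply/orP; right.
  have /and4P[wt _ _ kt] := tP; apply: leq_ltn_trans n2 _; rewrite ltnS.
  by case: t wt kt {tP} => [x|k cs] // /wf_node_leaves.
- have [f [fb fs]] := @trees_csum_catom s (pred1 1) (pred1 2) (predC1 0) isT isT isT
    ltac:(by case=> [|[|[]]]) ltac:(by move=> k; apply/andP => -[/eqP->]).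
  apply: equi_trans (@trees_set_ge s 0 n isT) _.
  exact: equi_sym (contractive_bij n (@contractive_set_ge s) (N _) fb fs).
- have [f [fb fs]] := @trees_csum_catom s (pred1 0) (pred1 2) (predC1 1) isT isT isT
    ltac:(by case=> [|[|[]]]) ltac:(by move=> k; apply/andP => -[/eqP->]).
  apply: equi_trans (@trees_set_ge s 1 n isT) _.
  exact: equi_sym (contractive_bij n (@contractive_set_ge s) (N _) fb fs).
have [f [fb fs]] := @trees_csum_catom s (pred1 0) (pred1 1) (predC1 2) isT isT isT
  ltac:(by case=> [|[|[]]]) ltac:(by move=> k; apply/andP => -[/eqP->]).
apply: equi_trans (trees_seq_ge s n) _.
exact: equi_sym (contractive_bij n (@contractive_seq_ge s) (N _) fb fs).
Qed.

Theorem theorem3 (s : setting) :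
  (exists D K SC SX : comb_class, dh_system s D K SC SX) /\
  (forall D K SC SX D' K' SC' SX' : comb_class,
     dh_system s D K SC SX -> dh_system s D' K' SC' SX' ->
     [/\ class_iso D D', class_iso K K', class_iso SC SC' & class_iso SX SX'])
  /\
  (forall D K SC SX : comb_class, dh_system s D K SC SX ->
     forall n : nat, 3 <= n -> equinumerous_at (rooted_dh_class s) D n).
Proof.
split; first by do 4!eexists; apply: trees_dh_system.
split; first exact: dh_system_unique.
(* Every solution agrees with the one built from canonical trees, whose first class consists of the
   graphs themselves. *)
move=> D K SC SX sys n n3; apply: equi_trans (rooted_dh_ge3_equi s n3) _.
by have [] := dh_system_unique (trees_dh_system s) sys.
Qed.
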